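(* Let $p$ be a prime and $d$ an integer with $1<d<p$ and $\phi(d)\le 2$. Then \[ {}_3G\left(\tfrac12, \tfrac1d, 1-\tfrac1d\right)_p \equiv {}_3F_2\left[\begin{matrix} \tfrac12, & \tfrac1d, & 1-\tfrac1d\\ & 1, & 1\end{matrix}\;\Big|\;1\right]_{p-1} \pmod{p^2}. \]
   Context: Truncated hypergeometric series: ${}_rF_s\left[\begin{matrix} a_1,\dots,a_r\\ b_1,\dots,b_s\end{matrix}\,\Big|\, z\right]_m := \sum_{n=0}^{m} \frac{(a_1)_n\cdots(a_r)_n}{(b_1)_n\cdots(b_s)_n}\frac{z^n}{n!}$ with $(a)_0=1$, $(a)_n=a(a+1)\cdots(a+n-1)$. Congruences are in $\mathbb{Z}_p$. $\Gamma_p$ is Morita's $p$-adic gamma function ($\Gamma_p(n)=(-1)^n\prod_{j<n,\,p\nmid j} j$ for $n\in\mathbb{N}$, extended continuously to $\mathbb{Z}_p$). $\omega$ is the Teichmüller character of $\mathbb{F}_p$ ($\omega(x)\equiv x\pmod p$, $\omega(0)=0$). For an odd prime $p$, positive integers $m_i,d_i$ ($1\le i\le n+1$) with $p\nmid d_i$ and $0<\frac{m_1}{d_1}\le\cdots\le\frac{m_{n+1}}{d_{n+1}}<1$, \[ {}_{n+1}G\left(\tfrac{m_1}{d_1},\dots,\tfrac{m_{n+1}}{d_{n+1}}\right)_p := \frac{-1}{p-1}\sum_{k=0}^{n+1}(-p)^k\sum_{j=\lfloor m_kr_k\rfloor+1}^{\lfloor m_{k+1}r_{k+1}\rfloor}\omega^{j(n+1)}(-1)\,\Gamma_p\!\left(\tfrac{j}{p-1}\right)^{n+1}\prod_{i=k+1}^{n+1}\frac{\Gamma_p\!\left(\frac{m_i}{d_i}-\frac{j}{p-1}\right)}{\Gamma_p\!\left(\frac{m_i}{d_i}\right)}\prod_{i=1}^{k}\frac{\Gamma_p\!\left(\frac{d_i+m_i}{d_i}-\frac{j}{p-1}\right)}{\Gamma_p\!\left(\frac{m_i}{d_i}\right)},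 \] with $r_i=\frac{p-1}{d_i}$, $m_0=-1$, $m_{n+2}=p-2$, $d_0=d_{n+2}=p-1$. Arguments of $G$ may be listed in any order; the meaning is that with arguments sorted ascending. *)

(* Defs.v *)
From HB Require Import structures.
From mathcomp Require Import all_boot all_order all_algebra.
From mathcomp Require Import boolp classical_sets filter topology_structure.

Set Implicit Arguments.
Unset Strict Implicit.
Unset Printing Implicit Defensive.

Import Order.TTheory GRing.Theory Num.Theory.
Local Open Scope classical_set_scope.
Local Open Scope ring_scope.

(* The ring Z_p, as the inverse limit of the rings Z/p^(n+1). Since 'Z_0 and
   'Z_1 are both Z/2, the limit is a nontrivial ring for every p : nat; it is
   the ring of p-adic integers when p is prime. *)

Definition Zpow_red (p n : nat) (x : 'Z_(p ^ n.+2)) : 'Z_(p ^ n.+1) :=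
  (x : nat)%:R.

Lemma dvdn_Zp_trunc_exp (p n : nat) :
  ((Zp_trunc (p ^ n.+1)).+2 %| (Zp_trunc (p ^ n.+2)).+2)%N.
Proof.
case: p => [|[|p]]; first by rewrite !exp0n.
  by rewrite !exp1n.
have p_gt1 m : (1 < p.+2 ^ m.+1)%N by rewrite -{1}(expn0 p.+2) ltn_exp2l.
by rewrite !Zp_cast ?dvdn_exp2l.
Qed.

Lemma Zpow_red_nat (p n m : nat) : @Zpow_red p n m%:R = m%:R.
Proof.
rewrite /Zpow_red Zp_nat /= !Zp_nat; apply/val_inj => /=.
by rewrite modn_dvdm ?dvdn_Zp_trunc_exp.
Qed.

Lemma Zpow_red_is_zmod_morphism (p n : nat) : zmod_morphism (@Zpow_red p n).
Proof.
have redD : {morph @Zpow_red p n : x y / x + y}.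
  move=> x y; rewrite -[x in LHS]natr_Zp -[y in LHS]natr_Zp -natrD.
  by rewrite Zpow_red_nat natrD.
move=> x y; apply/eqP; rewrite eq_sym subr_eq -redD.
by rewrite subrK.
Qed.

Lemma Zpow_red_is_monoid_morphism (p n : nat) : monoid_morphism (@Zpow_red p n).
Proof.
split=> [|x y]; first by rewrite -[1]/(1%:R) Zpow_red_nat.
by rewrite -[x in LHS]natr_Zp -[y in LHS]natr_Zp -natrM Zpow_red_nat natrM.
Qed.

HB.instance Definition _ (p n : nat) := GRing.isZmodMorphism.Build
  'Z_(p ^ n.+2) 'Z_(p ^ n.+1) (@Zpow_red p n) (@Zpow_red_is_zmod_morphism p n).
HB.instance Definition _ (p n : nat) := GRing.isMonoidMorphism.Build
  'Z_(p ^ n.+2) 'Z_(p ^ n.+1) (@Zpow_red p n) (@Zpow_red_is_monoid_morphism p n).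

Record padic_int (p : nat) := PadicInt {
  padic_res :> forall n, 'Z_(p ^ n.+1);
  padic_resP : forall n, Zpow_red (padic_res n.+1) = padic_res n
}.

Section PadicIntRing.
Variable p : nat.
Local Notation Zp := (padic_int p).
Implicit Types x y : Zp.

Lemma padic_intP x y : (forall n, x n = y n) -> x = y.
Proof.
case: x y => [x xP] [y yP] /= /(@functional_extensionality_dep _ _ x y) exy.
by rewrite -{y}exy in yP *; congr PadicInt; apply: Prop_irrelevance.
Qed.

HB.instance Definition _ := gen_eqMixin Zp.
HB.instance Definition _ := gen_choiceMixin Zp.

Definition padic_zero : Zp := PadicInt (fun n => rmorph0 (@Zpow_red p n)).
Definition padic_one : Zp := PadicInt (fun n => rmorph1 (@Zpow_red p n)).

Lemma padic_opp_subproof x n : Zpow_red (- x n.+1) = - x n.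
Proof. by rewrite rmorphN /= padic_resP. Qed.
Definition padic_opp x : Zp := PadicInt (padic_opp_subproof x).

Lemma padic_add_subproof x y n : Zpow_red (x n.+1 + y n.+1) = x n + y n.
Proof. by rewrite rmorphD /= !padic_resP. Qed.
Definition padic_add x y : Zp := PadicInt (padic_add_subproof x y).

Lemma padic_mul_subproof x y n : Zpow_red (x n.+1 * y n.+1) = x n * y n.
Proof. by rewrite rmorphM /= !padic_resP. Qed.
Definition padic_mul x y : Zp := PadicInt (padic_mul_subproof x y).

Let padic_addA : associative padic_add.
Proof. by move=> x y z; apply: padic_intP => n /=; rewrite addrA. Qed.
Let padic_addC : commutative padic_add.
Proof. by move=> x y; apply: padic_intP => n /=; rewrite addrC. Qed.
Let padic_add0 : left_id padic_zero padic_add.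
Proof. by move=> x; apply: padic_intP => n /=; rewrite add0r. Qed.
Let padic_addN : left_inverse padic_zero padic_opp padic_add.
Proof. by move=> x; apply: padic_intP => n /=; rewrite addNr. Qed.

HB.instance Definition _ :=
  GRing.isZmodule.Build Zp padic_addA padic_addC padic_add0 padic_addN.

Let padic_mulA : associative padic_mul.
Proof. by move=> x y z; apply: padic_intP => n /=; rewrite mulrA. Qed.
Let padic_mulC : commutative padic_mul.
Proof. by move=> x y; apply: padic_intP => n /=; rewrite mulrC. Qed.
Let padic_mul1 : left_id padic_one padic_mul.
Proof. by move=> x; apply: padic_intP => n /=; rewrite mul1r. Qed.
Let padic_mulD : left_distributive padic_mul padic_add.
Proof. by move=> x y z; apply: padic_intP => n /=; rewrite mulrDl. Qed.
Let padic_one_neq0 : padic_one != 0.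
Proof. by apply/eqP => /(congr1 (fun x : Zp => x 0%N)) /eqP; rewrite oner_eq0. Qed.

HB.instance Definition _ := GRing.Zmodule_isComNzRing.Build Zp
  padic_mulA padic_mulC padic_mul1 padic_mulD padic_one_neq0.

Definition padic_unit : {pred Zp} := fun x => `[< forall n, x n \is a GRing.unit >].

Lemma padic_inv_subproof x : (forall n, x n \is a GRing.unit) ->
  forall n, Zpow_red (x n.+1)^-1 = (x n)^-1.
Proof. by move=> xU n; rewrite rmorphV ?xU //= padic_resP. Qed.

Definition padic_inv x : Zp :=
  if pselect (forall n, x n \is a GRing.unit) is left xU
  then PadicInt (padic_inv_subproof xU) else x.

Let padic_mulV : {in padic_unit, left_inverse 1 padic_inv *%R}.
Proof.
move=> x /asboolP xU; rewrite /padic_inv; case: pselect => // xU'.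
by apply: padic_intP => n /=; rewrite mulVr ?xU.
Qed.

Let padic_unitPl x y : y * x = 1 -> padic_unit x.
Proof.
move=> yx1; apply/asboolP => n; apply/unitrPr; exists (y n).
by rewrite mulrC -[RHS]/((1 : Zp) n) -yx1.
Qed.

Let padic_invr_out : {in [predC padic_unit], padic_inv =1 id}.
Proof.
move=> x; rewrite inE => /asboolP xNU; rewrite /padic_inv.
by case: pselect => // xU; case: xNU.
Qed.

HB.instance Definition _ := GRing.ComNzRing_hasMulInverse.Build Zp
  padic_mulV padic_unitPl padic_invr_out.

(* The p-adic topology: a basis of neighbourhoods of x is given by the residue
   classes of x modulo p^(n+1). *)
Definition padic_nbhs x : set_system Zp :=
  filter_from [set: nat] (fun n => [set y : Zp | y n = x n]).

HB.instance Definition _ := hasNbhs.Build Zp padic_nbhs.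

Lemma padic_res_le x y (m n : nat) : (m <= n)%N -> x n = y n -> x m = y m.
Proof.
move/subnK <-; elim: (n - m)%N => [//|k IHk] exy; apply: IHk.
by rewrite -[LHS]padic_resP -[RHS]padic_resP; congr Zpow_red.
Qed.

Let padic_nbhs_filter x : ProperFilter (nbhs x).
Proof.
apply: filter_from_proper => [|n _]; last by exists x.
apply: filter_from_filter => [|m n _ _]; first by exists 0%N.
exists (maxn m n) => // y /= eyx.
by split; apply: padic_res_le eyx; rewrite ?leq_maxl ?leq_maxr.
Qed.

Let padic_nbhs_singleton x (A : set Zp) : nbhs x A -> A x.
Proof. by case=> n _; apply. Qed.

Let padic_nbhs_nbhs x (A : set Zp) : nbhs x A -> nbhs x (nbhs^~ A).
Proof.
by case=> n _ sA; exists n => // y /= eyx; exists n => // z /= ezy; apply: sA; rewrite /= ezy.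
Qed.

HB.instance Definition _ := Nbhs_isNbhsTopological.Build Zp
  padic_nbhs_filter padic_nbhs_singleton padic_nbhs_nbhs.

End PadicIntRing.

Definition padic_cong (p k : nat) (x y : padic_int p) : Prop :=
  exists z : padic_int p, x - y = p%:R ^+ k * z.

Definition morita_gamma_nat (p n : nat) : padic_int p :=
  (-1) ^+ n * \prod_(0 <= j < n | ~~ (p %| j)%N) j%:R.

Definition is_morita_gamma (p : nat) (f : padic_int p -> padic_int p) : Prop :=
  continuous f /\ forall n : nat, f n%:R = morita_gamma_nat p n.

Definition morita_gamma (p : nat) : padic_int p -> padic_int p :=
  xget (fun=> 0) [set f | is_morita_gamma f].

Definition is_teichmuller (p : nat) (w : 'F_p -> padic_int p) : Prop :=
  [/\ w 0 = 0, w 1 = 1, {morph w : x y / x * y}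
    & forall x : 'F_p, padic_cong 1 (w x) (x : nat)%:R].

Definition teichmuller (p : nat) : 'F_p -> padic_int p :=
  xget (fun=> 0) [set w | is_teichmuller w].

Section WellDefined.
Variable p : nat.
Hypothesis p_prime : prime p.

Let p_gt1 : (1 < p)%N. Proof. exact: prime_gt1. Qed.
Let pn_gt1 n : (1 < p ^ n.+1)%N.
Proof. by rewrite -{1}(expn0 p) ltn_exp2l. Qed.

Lemma padic_res_nat (m n : nat) : (m%:R : padic_int p) n = m%:R.
Proof. by elim: m => [//|m IHm]; rewrite -!natr1 /= IHm. Qed.

Lemma padic_res_prod (I : Type) (r : seq I) (P : pred I)
    (F : I -> padic_int p) (n : nat) :
  (\prod_(i <- r | P i) F i) n = \prod_(i <- r | P i) F i n.
Proof. by apply: (big_morph (fun x : padic_int p => x n)). Qed.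

Lemma padic_res_exp (x : padic_int p) (k n : nat) : (x ^+ k) n = x n ^+ k.
Proof. by elim: k => [//|k IHk]; rewrite !exprS /= IHk. Qed.

Lemma prod_window (R : comPzRingType) (h : nat -> R) (N m : nat) :
    (forall i, h (i + N)%N = h i) ->
  \prod_(m <= i < m + N) h i = \prod_(0 <= i < N) h i.
Proof.
move=> hN; elim: m => [//|m <-].
case: N hN => [|N] hN; first by rewrite !addn0 !big_geq.
rewrite addSn big_nat_recr /=; last by rewrite addnS ltnS leq_addr.
by rewrite hN mulrC -big_ltn // addnS ltnS leq_addr.
Qed.

Hypothesis p_odd : odd p.

Let unit_part (R : pzRingType) (i : nat) : R :=
  if ~~ (p %| i)%N then i%:R else 1.

Lemma dvdn_prod_unit_part (k : nat) :
  (p %| (\prod_(0 <= j < p ^ k.+1 | ~~ (p %| j)) j).+1)%N.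
Proof.
have period i : unit_part 'F_p (i + p) = unit_part 'F_p i.
  by rewrite /unit_part dvdn_addl // natrD pchar_Fp_0 // addr0.
have blocks m : \prod_(0 <= i < m * p) unit_part 'F_p i = (-1) ^+ m.
  elim: m => [|m IHm]; first by rewrite big_geq.
  rewrite mulSn addnC (@big_cat_nat _ _ _ (m * p)) ?leq_addr //= IHm.
  rewrite prod_window // exprSr; congr (_ * _).
  rewrite big_ltn ?prime_gt0 // {1}/unit_part dvdn0 /= mul1r.
  rewrite (@eq_big_nat _ _ _ _ _ _ (fun i => i%:R)); last first.
    by move=> i /andP[i0 ip]; rewrite /unit_part gtnNdvd.
  rewrite -natr_prod -(prednK (prime_gt0 p_prime)) -fact_prod.
  apply/eqP; rewrite -subr_eq0 opprK natr1 -[_%:R]natr_Zp.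
  have := Wilson p_gt1; rewrite p_prime => /esym.
  rewrite (dvdn_pcharf (pchar_Fp p_prime)) prednK ?prime_gt0 // => /eqP e.
  by rewrite natr_Zp e.
rewrite (dvdn_pcharf (pchar_Fp p_prime)) -natr1 natr_prod big_mkcond.
by rewrite expnSr blocks -signr_odd oddX p_odd orbT expr1 addNr.
Qed.

Lemma prod_unit_part (k : nat) :
  \prod_(0 <= j < p ^ k.+1 | ~~ (p %| j)%N) j%:R = -1 :> 'Z_(p ^ k.+1).
Proof.
set N := (p ^ k.+1)%N; have N1 : (1 < N)%N by apply: pn_gt1.
have cN m : coprime N m = ~~ (p %| m)%N.
  by rewrite /N coprime_pexpl // prime_coprime.
have := dvdn_prod_unit_part k; rewrite -/N.
set A := (\prod_(0 <= j < N | _) _)%N => pA.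
have EA : \prod_(0 <= j < N | ~~ (p %| j)%N) j%:R = A%:R :> 'Z_N by rewrite natr_prod.
have AA : A%:R * A%:R = 1 :> 'Z_N.
  have E : A%:R = \prod_(u : 'Z_N | u \is a GRing.unit) u.
    rewrite -EA -[X in \prod_(0 <= j < X | _) _](Zp_cast N1) big_mkord.
    by apply: eq_big => u; rewrite ?natr_Zp // -cN -unitZpE // natr_Zp.
  rewrite {2}E (reindex_inj (@invr_inj 'Z_N)) /=.
  rewrite (eq_bigl (fun u : 'Z_N => u \is a GRing.unit)) => [|u]; last exact: unitrV.
  by rewrite E -big_split big1 // => u uU; rewrite /= divrr.
have A0 : (0 < A)%N.
  by rewrite prodn_cond_gt0 // => -[|j]; rewrite ?dvdn0.
have NA : (N %| A.+1)%N.
  have cA : coprime N A.-1.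
    rewrite cN; apply: contraL (odd_prime_gt2 p_odd p_prime) => pA1.
    rewrite -leqNgt dvdn_leq //.
    by rewrite -(dvdn_addr _ pA1) addn2 -[A.-1.+2]/((A.-1.+1).+1) prednK.
  rewrite -(Gauss_dvdr _ cA) -subn1 -[A.+1]addn1 -subn_sqr.
  rewrite -eqn_mod_dvd ?expn_gt0 ?A0 //; apply/eqP.
  have := congr1 (fun x : 'Z_N => x : nat) AA.
  by rewrite -natrM !val_Zp_nat // mulnn => ->; rewrite exp1n modn_small.
rewrite EA; apply/eqP; rewrite -subr_eq0 opprK natr1.
by rewrite -Zp_nat_mod // (eqP NA).
Qed.


Lemma morita_gamma_res (m n : nat) :
  morita_gamma_nat p m n =
    (-1) ^+ m * \prod_(0 <= j < m | ~~ (p %| j)%N) j%:R :> 'Z_(p ^ n.+1).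
Proof.
rewrite /morita_gamma_nat /= padic_res_exp padic_res_prod /=.
by congr (_ * _); apply: eq_bigr => j _; rewrite padic_res_nat.
Qed.

Lemma morita_gamma_res_mod (m n : nat) :
  morita_gamma_nat p (m %% p ^ n.+1)%N n = morita_gamma_nat p m n.
Proof.
have period k : morita_gamma_nat p (k + p ^ n.+1)%N n = morita_gamma_nat p k n.
  have window : \prod_(k <= j < k + p ^ n.+1 | ~~ (p %| j)%N) j%:R
      = -1 :> 'Z_(p ^ n.+1).
    rewrite -prod_unit_part big_mkcond [RHS]big_mkcond.
    rewrite (@prod_window _ (fun j => if ~~ (p %| j)%N then j%:R else 1)) // => i.
    by rewrite dvdn_addl ?dvdn_exp // natrD pchar_Zp // addr0.
  rewrite !morita_gamma_res (@big_cat_nat _ _ _ k) ?leq_addr //= window.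
  by rewrite exprD -(signr_odd _ (p ^ _)) oddX p_odd orbT expr1 !mulrN1 mulrNN.
rewrite [in RHS](divn_eq m (p ^ n.+1)).
by elim: (m %/ _)%N => [//|k ->]; rewrite mulSn -addnA [(p ^ _ + _)%N]addnC period.
Qed.

Lemma padic_res_val (x : padic_int p) (n : nat) :
  x n = ((x n.+1 : nat) %% p ^ n.+1)%N :> nat.
Proof. by rewrite -padic_resP /Zpow_red val_Zp_nat. Qed.

Lemma morita_gamma_subproof (x : padic_int p) (n : nat) :
  Zpow_red (morita_gamma_nat p (x n.+1) n.+1) = morita_gamma_nat p (x n) n.
Proof. by rewrite padic_resP (padic_res_val x n) morita_gamma_res_mod. Qed.

Lemma is_morita_gamma_exists : exists f, @is_morita_gamma p f.
Proof.
exists (fun x => PadicInt (morita_gamma_subproof x)); split=> [x A [n _ sA]|m].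
  by exists n => // y /= eyx; apply: sA; rewrite /= eyx.
apply: padic_intP => n.
rewrite -[LHS]/(morita_gamma_nat p ((m%:R : padic_int p) n) n).
by rewrite padic_res_nat val_Zp_nat // morita_gamma_res_mod.
Qed.

Lemma is_morita_gamma_unique (f g : padic_int p -> padic_int p) :
  is_morita_gamma f -> is_morita_gamma g -> f = g.
Proof.
move=> [fC fN] [gC gN]; apply/funext => x; apply: padic_intP => n.
have basis (h : padic_int p -> padic_int p) : continuous h ->
    exists k, forall y : padic_int p, y k = x k -> h y n = h x n.
  move=> /(_ x [set z : padic_int p | z n = h x n]) [|k _ sk]; first by exists n.
  by exists k => y exy; apply: (sk y).
have [k fk] := basis f fC; have [l gl] := basis g gC.
pose y : padic_int p := (x (maxn k l) : nat)%:R.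
have ey : y (maxn k l) = x (maxn k l) by rewrite padic_res_nat natr_Zp.
rewrite -(fk y) ?(padic_res_le _ ey) ?leq_maxl //.
by rewrite -(gl y) ?(padic_res_le _ ey) ?leq_maxr // /y fN gN.
Qed.

Lemma morita_gammaP : is_morita_gamma (@morita_gamma p).
Proof. exact: (xgetPex _ is_morita_gamma_exists). Qed.

End WellDefined.

Section Teichmuller.
Variable p : nat.
Hypothesis p_prime : prime p.

Let p_gt1 : (1 < p)%N. Proof. exact: prime_gt1. Qed.
Let pn_gt1 n : (1 < p ^ n.+1)%N.
Proof. by rewrite -{1}(expn0 p) ltn_exp2l. Qed.

Lemma lift_exp_p (a b n : nat) : a = b %[mod p] ->
  a%:R ^+ (p ^ n) = b%:R ^+ (p ^ n) :> 'Z_(p ^ n.+1).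
Proof.
move=> eab; suff: (a ^ (p ^ n) = b ^ (p ^ n) %[mod p ^ n.+1])%N.
  by move=> e; rewrite -!natrX -[LHS]Zp_nat_mod // -[RHS]Zp_nat_mod // e.
wlog leba : a b eab / (b <= a)%N.
  by move=> H; case/orP: (leq_total b a) => le; [|symmetry]; apply: H.
elim: n => [|n IHn]; first by rewrite !expn1.
apply/eqP; rewrite eqn_mod_dvd ?leq_exp2r ?expn_gt0 ?prime_gt0 //.
rewrite [(p ^ n.+1)%N]expnSr !expnM; set c := (a ^ _)%N in IHn *; set e := (b ^ _)%N in IHn *.
have lec : (e <= c)%N by rewrite leq_exp2r // expn_gt0 prime_gt0.
clearbody c e.
rewrite subn_exp [(p ^ n.+2)%N]expnSr dvdn_mul //.
  by rewrite -eqn_mod_dvd //; apply/eqP.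
rewrite (dvdn_pcharf (pchar_Fp p_prime)) natr_sum.
have ece : c%:R = e%:R :> 'F_p.
  apply: val_inj; rewrite /= !val_Fp_nat //.
  apply/eqP; rewrite eqn_mod_dvd // (dvdn_trans _ (_ : p ^ n.+1 %| _)%N) ?dvdn_exp //.
  by rewrite -eqn_mod_dvd //; apply/eqP.
rewrite (eq_bigr (fun=> e%:R ^+ p.-1)) => [|i _].
  by rewrite sumr_const card_ord (mulrn_pchar (pchar_Fp p_prime)).
rewrite natrM !natrX ece -exprD; congr (_ ^+ _).
by rewrite subnK // -ltnS prednK ?ltn_ord // prime_gt0.
Qed.

Lemma teichmuller_subproof (x : 'F_p) (n : nat) :
  Zpow_red ((x : nat)%:R ^+ (p ^ n.+1) : 'Z_(p ^ n.+2))
    = (x : nat)%:R ^+ (p ^ n).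
Proof.
rewrite -natrX Zpow_red_nat natrX [X in _ ^+ X = _]expnS exprM -(natrX _ x p); apply: lift_exp_p.
rewrite -!(val_Fp_nat p_prime) natrX natr_Zp.
by rewrite -{1}(natr_Zp x) -(pFrobenius_autE (pchar_Fp p_prime)) rmorph_nat natr_Zp.
Qed.

Lemma padic_res_mod (x : padic_int p) (m n : nat) : (m <= n)%N ->
  x m = ((x n : nat) %% p ^ m.+1)%N :> nat.
Proof.
move/subnK <-; elim: (n - m)%N => [|k IHk].
  by rewrite add0n -(val_Zp_nat (pn_gt1 m)) natr_Zp.
rewrite IHk (padic_res_val p_prime x (k + m)) modn_dvdm // dvdn_exp2l //.
by rewrite ltnS leq_addl.
Qed.

Lemma padic_divp_subproof (k : nat) (x : padic_int p) (n : nat) :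
  Zpow_red (((x (n.+1 + k.+1)%N : nat) %/ p ^ k.+1)%N%:R)
    = ((x (n + k.+1)%N : nat) %/ p ^ k.+1)%N%:R :> 'Z_(p ^ n.+1).
Proof.
rewrite Zpow_red_nat -[LHS]Zp_nat_mod // -[RHS]Zp_nat_mod //; congr _%:R.
have -> : x (n + k.+1)%N = (x (n.+1 + k.+1)%N %% (p ^ n.+1 * p ^ k.+1))%N :> nat.
  by rewrite (padic_res_val p_prime x); congr (_ %% _)%N; rewrite -expnD.
by rewrite -modn_divl modn_mod.
Qed.

Lemma padic_congP (k : nat) (x y : padic_int p) :
  padic_cong k.+1 x y <-> x k = y k.
Proof.
split=> [[z /(congr1 (fun u : padic_int p => u k))] | exy].
  rewrite /= padic_res_exp padic_res_nat -natrX pchar_Zp // mul0r.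
  by move=> /eqP; rewrite subr_eq0 => /eqP.
exists (PadicInt (padic_divp_subproof k (x - y))); apply: padic_intP => n.
set u := x - y.
have uk : u k = 0 by rewrite /u /= exy subrr.
transitivity ((p ^ k.+1 * ((u (n + k.+1)%N : nat) %/ p ^ k.+1))%N%:R : 'Z_(p ^ n.+1)).
  rewrite mulnC divnK; last first.
    by rewrite /dvdn -padic_res_mod ?uk // (leq_trans (leqnSn k)) // leq_addl.
  by rewrite -[RHS]Zp_nat_mod // -padic_res_mod ?leq_addr // natr_Zp.
by rewrite natrM /= padic_res_exp padic_res_nat natrX.
Qed.

Lemma is_teichmuller_exists : exists w, @is_teichmuller p w.
Proof.
exists (fun x => PadicInt (teichmuller_subproof x)); split=> [||x y|x].
- by apply: padic_intP => n /=; rewrite expr0n expn_eq0 eqn0Ngt prime_gt0.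
- apply: padic_intP => n /=; rewrite -[RHS](expr1n _ (p ^ n)).
  exact: (@lift_exp_p _ 1%N n).
- have xyE : nat_of_ord (x * y) = ((x : nat) * (y : nat))%N %[mod p].
    have -> : x * y = ((x : nat) * (y : nat))%N%:R by rewrite natrM !natr_Zp.
    by rewrite val_Fp_nat // modn_mod.
  apply: padic_intP => n /=; rewrite -exprMn -natrM; exact: lift_exp_p xyE.
- by apply/padic_congP; rewrite padic_res_nat /= expr1.
Qed.

Lemma is_teichmuller_unique (w v : 'F_p -> padic_int p) :
  is_teichmuller w -> is_teichmuller v -> w = v.
Proof.
move=> [_ w1 wM wcong] [_ v1 vM vcong].
have expp (u : 'F_p -> padic_int p) : u 1 = 1 -> {morph u : x y / x * y} ->
    forall x n, u x = u x ^+ (p ^ n).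
  move=> u1 uM x; elim=> [|n {1}->]; first by rewrite expr1.
  rewrite expnS exprM; congr (_ ^+ _).
  have uX m : u x ^+ m = u (x ^+ m) by elim: m => [//|m IHm]; rewrite !exprS IHm uM.
  rewrite uX; congr (u _); symmetry.
  by rewrite -{1}(natr_Zp x) -(pFrobenius_autE (pchar_Fp p_prime)) rmorph_nat natr_Zp.
apply/funext => x; apply: padic_intP => n.
rewrite (expp w w1 wM x n) (expp v v1 vM x n) !padic_res_exp.
rewrite -[w x n]natr_Zp -[v x n]natr_Zp; apply: lift_exp_p.
have := wcong x => /padic_congP wx; have := vcong x => /padic_congP vx.
have := congr1 (fun y => nat_of_ord y) (etrans wx (esym vx)).
by rewrite !(@padic_res_mod _ 0 n).
Qed.

Lemma teichmullerP : is_teichmuller (@teichmuller p).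
Proof. exact: (xgetPex _ is_teichmuller_exists). Qed.

End Teichmuller.

Definition pochhammer (R : pzRingType) (a : R) (n : nat) : R :=
  \prod_(i < n) (a + i%:R).

Definition hypergeometric_trunc (R : comUnitRingType) (a b : seq R) (z : R)
    (m : nat) : R :=
  \sum_(n < m.+1)
    (\prod_(x <- a) pochhammer x n) / (\prod_(x <- b) pochhammer x n)
    * (z ^+ n / n`!%:R).

(* The function G(m_1 / d_1, ..., m_(n+1) / d_(n+1))_p, with r_k = (p - 1) / d_k.
   The arguments are the rational numbers m_i / d_i, in any order. With s the
   sorted list of arguments, [a k] below is m_k / d_k for 1 <= k <= n + 1, while
   a 0 = -1 / (p - 1) and a (n + 2) = (p - 2) / (p - 1); thus m_k r_k is
   [a k * (p - 1)]. These products are at least -1, so that the summation bounds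
   floor(m_k r_k) + 1 are natural numbers. *)
Definition padic_hypergeometric (p : nat) (args : seq rat) : padic_int p :=
  let s := sort <=%R args in
  let N := size s in
  let a k : rat := nth 0 (- (p.-1%:R)^-1 :: rcons s (p.-2%:R / p.-1%:R)) k in
  let bound k : nat := absz (Num.floor (a k * p.-1%:R) + 1) in
  let G (x : rat) : padic_int p := morita_gamma (ratr x) in
  - 1 / p.-1%:R *
  \sum_(0 <= k < N.+1) (- p%:R) ^+ k *
    \sum_(bound k <= j < bound k.+1)
      teichmuller (-1 : 'F_p) ^+ (j * N) * G (j%:R / p.-1%:R) ^+ N
      * (\prod_(k.+1 <= i < N.+1) (G (a i - j%:R / p.-1%:R) / G (a i)))
      * (\prod_(1 <= i < k.+1) (G (1 + a i - j%:R / p.-1%:R) / G (a i))).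

(* Main.v *)
(** The arguments of G enter modulo p^2 only. There, with M = j (p + 1), one has
    -j/(p-1) = M, and both the j-th term of G and the j-th term of the 3F2 are
    expressed through products (a)_M / M! and (a)_j / j! from which the multiples
    of p have been removed. Put n = floor((p-1)/d), m = (p-1)/2 and
      F(x) = C(n+x, n) C(m+x, m) C(p-1-n+x, p-1-n),
    a polynomial of degree at most 2p - 3 in x over Z/p^2. As phi(d) <= 2 forces
    p = 1 or -1 mod d, the three parameters are n+1, m+1, p-n modulo p, and for
    every j < p the difference of the j-th terms is (1+p) F((1+p) j) - F(j)
    modulo p^2. A monomial x^k of F contributes p (k+1) j^k; since p divides
    (k+1) sum_(j<p) j^k for all k <= 2p - 3 (for k = p-1 because of the factor
    k+1), the sum of these differences vanishes. *)

Require Import Defs.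
From HB Require Import structures.
From mathcomp Require Import all_boot all_order all_algebra.
From mathcomp Require Import boolp classical_sets filter topology_structure.
From mathcomp Require Import zify ring lra.

Set Implicit Arguments.
Unset Strict Implicit.
Unset Printing Implicit Defensive.

Import Order.TTheory GRing.Theory Num.Theory.
Local Open Scope ring_scope.

Lemma big_nat_translate (R : Type) (idx : R) (op : R -> R -> R) (F : nat -> R) x n :
  \big[op/idx]_(x <= i < x + n) F i = \big[op/idx]_(0 <= i < n) F (x + i)%N.
Proof.
rewrite -{1}[x]add0n big_addn addKn; apply: eq_bigr => i _.
by rewrite addnC.
Qed.

(** * Power sums modulo p *)

Section PowerSums.
Variable p : nat.
Hypothesis p_prime : prime p.

(** Telescoping [(j+1)^(k+1) - j^(k+1)] over j < p writes [p^(k+1)] through the power sums of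
    exponent at most k. The lower ones are divisible by p by induction, and the coefficient [k+1] of
    the last one is prime to p. *)
Lemma dvdn_sum_exp_lt k : (k < p.-1)%N -> (p %| \sum_(0 <= j < p) j ^ k)%N.
Proof.
have p_gt0 := prime_gt0 p_prime.
elim/ltn_ind: k => k IHk lt_kp.
have : (p ^ k.+1 =
    0 ^ k.+1 + \sum_(0 <= j < p) \sum_(i < k.+1) 'C(k.+1, i) * j ^ i)%N.
  elim: (p) => [|q IHq]; first by rewrite big_geq ?addn0.
  rewrite big_nat_recr //= addnA -IHq -add1n expnDn big_ord_recr /= addnC.
  rewrite subnn binn !mul1n; congr addn; apply: eq_bigr => i _.
  by rewrite exp1n mul1n.
rewrite exp0n // add0n exchange_big /= big_ord_recr /= -big_distrr /=.
move=> sumE; have : (p %| p ^ k.+1)%N by rewrite expnS dvdn_mulr.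
rewrite sumE dvdn_addr.
  by rewrite binSn mulnC Gauss_dvdl // prime_coprime // gtnNdvd //; lia.
by apply: dvdn_sum => i _; rewrite -big_distrr dvdn_mull ?IHk // (ltn_trans _ lt_kp).
Qed.

(** At [k = p-1] the factor [k+1] is p itself; beyond it, Fermat lowers the exponent by [p-1] into
    the range of [dvdn_sum_exp_lt]. *)
Lemma dvdn_sum_exp k : (k < p.-1.*2)%N ->
  (p %| k.+1 * \sum_(0 <= j < p) j ^ k)%N.
Proof.
move=> lt_k; have p_gt1 := prime_gt1 p_prime.
case: (ltngtP k p.-1) => [lt_kp|gt_kp|->]; last by rewrite prednK ?dvdn_mulr //; lia.
  by rewrite dvdn_mull // dvdn_sum_exp_lt.
rewrite dvdn_mull //; have := @dvdn_sum_exp_lt (k - p.-1) ltac:(lia).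
congr is_true; congr eq_op.
rewrite -[LHS]modn_summ -[RHS]modn_summ; congr (_ %% _)%N.
apply: eq_bigr => j _.
have -> : (j ^ k = j ^ p * j ^ (k - p))%N by rewrite -expnD; congr expn; lia.
rewrite -modnMml fermat_little // modnMml -expnS; congr (_ ^ _ %% _)%N; lia.
Qed.

End PowerSums.

(** * Products of integers prime to p in a ring where p^2 = 0 *)

Section ModP2.
Variables (p : nat) (R : comUnitRingType).
Local Notation e := (@GRing.natmul R 1 p).
Hypotheses (p_prime : prime p) (p_odd : odd p).
(** R abstracts Z/p^2. [ann_e] turns a congruence modulo p, tested by multiplication by e, into an
    explicit multiple of e. *)
Hypothesis ee : e * e = 0.
Hypothesis unit_nat : forall i : nat, ~~ (p %| i)%N -> i%:R \is a @GRing.unit R.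
Hypothesis ann_e : forall x : R, e * x = 0 -> exists y, x = e * y.

Let p_gt2 : (2 < p)%N. Proof. exact: odd_prime_gt2. Qed.

Lemma sum_horner_twist (F : {poly R}) : (size F <= p.-1.*2)%N ->
  \sum_(0 <= j < p) ((1 + e) * F.[j%:R * (1 + e)] - F.[j%:R]) = 0.
Proof.
move=> sF; pose c (k j : nat) := (1 + e) * (j%:R * (1 + e)) ^+ k - j%:R ^+ k.
have expe k : (1 + e) ^+ k = 1 + e *+ k.
  elim: k => [|k IHk]; first by rewrite expr0 addr0.
  rewrite exprS IHk mulrDl mul1r mulrDr mulr1 mulrnAr ee mul0rn addr0.
  by rewrite -addrA -mulrSr.
rewrite (eq_bigr (fun j => \sum_(k < size F) F`_k * c k j)); last first.
  move=> j _; rewrite !horner_coef mulr_sumr -sumrB; apply: eq_bigr => k _.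
  by rewrite /c mulrBr mulrCA.
rewrite exchange_big /= big1 // => k _; rewrite -mulr_sumr.
(* Only the part of [(1+e)^(k+1)] linear in e survives; it is the source of the factor [k+1]. *)
have -> : \sum_(0 <= j < p) c k j = e * (k.+1 * \sum_(0 <= j < p) j ^ k)%N%:R.
  rewrite natrM natr_sum mulr_sumr mulr_sumr; apply: eq_bigr => j _.
  rewrite /c exprMn mulrCA -exprS expe mulrDr mulr1 addrAC subrr add0r natrX.
  by rewrite -[e *+ _]mulr_natr mulrCA [_ * k.+1%:R]mulrC.
have /dvdnP[s ->] := dvdn_sum_exp p_prime (leq_trans (ltn_ord k) sF).
by rewrite natrM [s%:R * _]mulrC [e * _]mulrA ee mul0r mulr0.
Qed.

(* In a ring where p^2 = 0, congruence modulo p is stated as equality after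
   multiplication by e = p. *)
Definition pfree (i : nat) : R := if (p %| i)%N then 1 else i%:R.

Lemma pfree_unit i : pfree i \is a GRing.unit.
Proof. by rewrite /pfree; case: ifPn => [_|/unit_nat //]; rewrite unitr1. Qed.

Lemma prod_pfree_unit a b : \prod_(a <= i < b) pfree i \is a GRing.unit.
Proof. by apply: rpred_prod => i _; apply: pfree_unit. Qed.

Lemma e_pfreeDp i : e * pfree (i + p) = e * pfree i.
Proof.
rewrite /pfree dvdn_addl //; case: ifP => // _.
by rewrite natrD mulrDr ee addr0.
Qed.

Lemma e_pfree_mod i j : i = j %[mod p] -> e * pfree i = e * pfree j.
Proof.
move=> eij; have red k : e * pfree k = e * pfree (k %% p).
  rewrite [in LHS](divn_eq k p) addnC.
  elim: (k %/ p)%N => [|q IHq]; first by rewrite addn0.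
  by rewrite mulSn [(p + _)%N]addnC addnA e_pfreeDp.
by rewrite red eij -red.
Qed.

Definition window x := \prod_(x <= i < x + p) pfree i.

Lemma window_unit x : window x \is a GRing.unit.
Proof. exact: prod_pfree_unit. Qed.

Lemma windowS x : window x.+1 * pfree x = window x * pfree (x + p).
Proof.
rewrite /window mulrC -big_ltn ?addSn ?ltnS ?leq_addr //.
by rewrite big_nat_recr ?leq_addr.
Qed.

(** Moving the start by one trades [pfree x] for [pfree (x + p)], and these agree modulo p. *)
Lemma e_window x y : e * window x = e * window y.
Proof.
suff w0 z : e * window z = e * window 0 by rewrite !w0.
elim: z => [//|z <-]; apply: (mulIr (pfree_unit z)).
by rewrite -mulrA windowS mulrCA e_pfreeDp mulrCA mulrA.
Qed.

(** The product of g over [z <= i < z + p] is [window (z + p) / window z]. *)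
Let g i := pfree (i + p) / pfree i.

(** Modulo p^2, [i (i + 2p) = (i + p)^2]. *)
Let gDp i : g (i + p) = g i.
Proof.
rewrite /g; apply: (mulIr (pfree_unit (i + p))); apply: (mulIr (pfree_unit i)).
rewrite divrK ?pfree_unit // mulrAC divrK ?pfree_unit //.
rewrite /pfree !dvdn_addl //; case: ifP => // _; rewrite !natrD.
by rewrite mulrDr !mulrDl ee; ring.
Qed.

(* The factors at i and p - i cancel, as (i + p) (2 p - i) = i (p - i) mod p^2. *)
Let prod_g : \prod_(0 <= i < p) g i = 1.
Proof.
have g0 : g 0 = 1.
  by rewrite /g add0n /pfree dvdnn dvdn0 divr1.
(* Each [g i] is 1 modulo p, so the product has the form [1 + e y]. *)
have [y gy] : exists y, \prod_(0 <= i < p) g i - 1 = e * y.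
  apply: ann_e; rewrite mulrBr mulr1; apply/eqP; rewrite subr_eq0; apply/eqP.
  elim: (X in index_iota 0 X) => [|q IHq]; first by rewrite big_geq ?mulr1.
  by rewrite big_nat_recr //= mulrA IHq /g mulrA e_pfreeDp mulrK ?pfree_unit.
have : (\prod_(0 <= i < p) g i) * (\prod_(0 <= i < p) g i) = 1.
  rewrite !(@big_ltn _ _ _ 0) ?(ltnW (ltnW p_gt2)) // g0 !mul1r.
  rewrite {2}big_nat_rev -big_split /= big_nat big1 // => i /andP[i0 ip].
  rewrite add1n subSS /g mulrACA -invrM ?pfree_unit //.
  have ni : ~~ (p %| i)%N by rewrite gtnNdvd.
  have npi : ~~ (p %| p - i)%N by rewrite gtnNdvd ?subn_gt0 //; lia.
  have := unit_nat npi; have := unit_nat ni.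
  rewrite /pfree !dvdn_addl // !ifN // !natrD natrB ?(ltnW ip) //.
  set x := i%:R => ux upx.
  have -> : (x + e) * (e - x + e) = (e - x) * x.
    transitivity ((e - x) * x + (e * e) *+ 2); last by rewrite ee mul0rn addr0.
    move: (e) (x) => u v; ring.
  by rewrite divrr // unitrM upx.
have -> : \prod_(0 <= i < p) g i = 1 + e * y by rewrite -gy addrCA subrr addr0.
(* Since [(1 + e y)^2 = 1 + 2 e y], the square being 1 gives [2 e y = 0], and 2 is a unit as p >
   2. *)
move=> h; have : e * y *+ 2 = 0.
  rewrite (_ : _ *+ 2 = (1 + e * y) * (1 + e * y) - 1 - (e * e) * y * y); last by ring.
  by rewrite h ee !mul0r !subrr.
rewrite -mulr_natr => h2; have u2 : 2%:R \is a @GRing.unit R.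
  by rewrite unit_nat // gtnNdvd.
by rewrite (_ : e * y = 0) ?addr0 //; apply: (mulIr u2); rewrite h2 mul0r.
Qed.

(** Shifting the start by p multiplies the window by a full period of g, which is 1. For congruent
    starts this sharpens [e_window] to an equality modulo p^2. *)
Lemma window_mod x y : x = y %[mod p] -> window x = window y.
Proof.
have wDp z : window (z + p) = window z.
  transitivity (window z * \prod_(z <= i < z + p) g i); last first.
    by rewrite (prod_window _ gDp) prod_g mulr1.
  rewrite /window -big_split (big_nat_translate _ _ _ z).
  rewrite (big_nat_translate _ _ _ (z + p)) /=; apply: eq_bigr => i _.
  by rewrite /g mulrC divrK ?pfree_unit // addnAC.
move=> exy; have red z : window z = window (z %% p).
  rewrite [in LHS](divn_eq z p) addnC.
  elim: (z %/ p)%N => [|q IHq]; first by rewrite addn0.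
  by rewrite mulSn [(p + _)%N]addnC addnA wDp.
by rewrite red exy -red.
Qed.

Lemma prod_window_exp x c : \prod_(x <= i < x + c * p) pfree i = window x ^+ c.
Proof.
elim: c => [|c IHc]; first by rewrite addn0 big_geq.
rewrite mulSn (@big_cat_nat _ _ _ (x + c * p)) /=; try lia.
rewrite IHc exprSr -(@window_mod (x + c * p) x) ?[(x + c * p)%N]addnC ?modnMDl //.
by rewrite /window; congr (_ * \prod_(_ <= i < _) _); lia.
Qed.

(* (A)_M / M! with every multiple of p replaced by 1. *)
Definition pfree_poch A M := \prod_(0 <= i < M) (pfree (A + i) / pfree i.+1).
Local Notation Q := pfree_poch.

Lemma pfree_poch_unit A M : Q A M \is a GRing.unit.
Proof. by apply: rpred_prod => i _; rewrite unitrM unitrV !pfree_unit. Qed.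

Lemma pfree_poch_quot A M :
  Q A M = \prod_(0 <= i < M) pfree (A + i) / \prod_(0 <= i < M) pfree i.+1.
Proof. by rewrite /pfree_poch big_split prodrV // => i _; apply: pfree_unit. Qed.

(** The [c p] factors after the first j form c full windows. By [window_mod] the resulting ratio
    depends on A only modulo p, although the equality holds modulo p^2. *)
Lemma pfree_poch_addp A j c :
  Q A (j + c * p) = Q A j * (window (A + j) / window j.+1) ^+ c.
Proof.
rewrite !pfree_poch_quot expr_div_n -!prod_window_exp mulrACA.
rewrite -invrM ?prod_pfree_unit //; last by apply: rpred_prod => *; apply: pfree_unit.
rewrite !(@big_cat_nat _ _ _ j 0 (j + _)) ?leq_addr //=.
rewrite 2!(big_nat_translate _ _ _ j) (big_nat_translate _ _ _ (A + j)).
rewrite (big_nat_translate _ _ _ j.+1).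
by congr (_ * _ / _); rewrite 1?mulrC; [|congr (_ * _)];
  apply: eq_bigr => i _; rewrite ?addnA.
Qed.

Lemma e_div_pfree i j k : i = j %[mod p] -> e * (pfree i / pfree k) = e * (pfree j / pfree k).
Proof. by move=> eij; rewrite mulrA (e_pfree_mod eij) mulrA. Qed.

Lemma pfree_pochS A M : Q A M.+1 = Q A M * (pfree (A + M) / pfree M.+1).
Proof. by rewrite /pfree_poch big_nat_recr. Qed.

Lemma e_pfree_poch_mod A B M : A = B %[mod p] -> e * Q A M = e * Q B M.
Proof.
move=> eAB; elim: M => [|M IHM]; first by rewrite /pfree_poch !big_geq.
rewrite !pfree_pochS mulrA IHM -mulrA mulrCA (@e_div_pfree _ (B + M)) 1?mulrCA //.
by rewrite -modnDml eAB modnDml.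
Qed.

Lemma e_pfree_poch_addp A j c : e * Q A (j + c * p) = e * Q A j.
Proof.
have ew : e * (window (A + j) / window j.+1) = e.
  by rewrite mulrA (e_window _ j.+1) mulrK ?window_unit.
rewrite pfree_poch_addp mulrCA; elim: c => [|c IHc]; first by rewrite mulr1 mulrC.
by rewrite exprS (mulrA e (_ / _)) ew.
Qed.

(** Let [H n] be the factorial of n with multiples of p replaced by 1. Both sides are
    [H (M + N) / (H M H N)], as for binomial coefficients. *)
Lemma pfree_poch_sym M N : Q N.+1 M = Q M.+1 N.
Proof.
pose H n := \prod_(0 <= i < n) pfree i.+1.
have HU n : H n \is a GRing.unit by apply: rpred_prod => i _; apply: pfree_unit.
have QE a b : Q a.+1 b = H (a + b)%N / (H a * H b).
  rewrite pfree_poch_quot /H (@big_cat_nat _ _ _ a _ (a + b)) ?leq_addr //=.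
  rewrite (big_nat_translate _ _ _ a) -!/(H _) [H a * H b]mulrC invrM //.
  by rewrite [H a * _]mulrC mulrA mulrK.
by rewrite !QE addnC [H N * _]mulrC.
Qed.

(** * Binomial coefficients and Pochhammer symbols in terms of Q *)

Lemma natr_binS n k : k.+1%:R \is a @GRing.unit R ->
  'C(n.+1, k.+1)%:R = 'C(n, k)%:R * (n.+1%:R / k.+1%:R) :> R.
Proof.
move=> uk; apply: (mulIr uk); rewrite mulrA divrK // -!natrM.
by rewrite mulnC -mul_bin_diag mulnC.
Qed.

(** Among the numerators [j + c p + 1, ..., j + c p + N] at most one is a multiple of p, namely
    [(c+1) p], and it occurs exactly when [N + j >= p]. *)
Lemma natr_bin_pfree N c j : (N < p)%N -> (j < p)%N ->
  'C(N + (j + c * p), N)%:R =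
    Q N.+1 (j + c * p) * (if (N + j < p)%N then 1 else e * c.+1%:R).
Proof.
move=> + jp; rewrite pfree_poch_sym; elim: N => [|N IHN] Np.
  by rewrite bin0 /pfree_poch big_geq // add0n jp mulr1.
have nN : ~~ (p %| N.+1)%N by rewrite gtnNdvd.
rewrite addSn natr_binS ?unit_nat // IHN ?(ltnW Np) // pfree_pochS.
rewrite {2}/pfree (negPf nN) /pfree.
have -> : ((j + c * p).+1 + N = (N + (j + c * p)).+1)%N by lia.
have -> : (p %| (N + (j + c * p)).+1)%N = ((N + j).+1 == p)%N.
  rewrite addnA -addSn dvdn_addl ?dvdn_mull //.
  apply/idP/eqP => [/dvdnP[[|[|q]] eq]|<-//]; nia.
case: (ltngtP (N + j).+1 p) => [lt|gt|eq].
- by rewrite !mulr1.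
- by rewrite mulrAC.
rewrite mulr1 mul1r.
have -> : ((N + (j + c * p)).+1 = p * c.+1)%N by lia.
by rewrite natrM; ring.
Qed.

Lemma fact_unit j : (j < p)%N -> j`!%:R \is a @GRing.unit R.
Proof.
elim: j => [|j IHj] jp; first by rewrite unitr1.
by rewrite factS natrM unitrM unit_nat ?gtnNdvd // IHj // ltnW.
Qed.

(** Among [A, ..., A + j - 1] the only possible multiple of p is [A + (p-1-N)], reached exactly when
    [N + j >= p]. It is kept as it stands because its class modulo p^2 depends on A. *)
Lemma pochhammer_pfree A N j : (N < p)%N -> (j < p)%N -> A = N.+1 %[mod p] ->
  pochhammer A%:R j / j`!%:R =
    Q A j * (if (N + j < p)%N then 1 else A%:R + (p.-1 - N)%:R).
Proof.
move=> Np + eA; elim: j => [|j IHj] jp.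
  by rewrite /pfree_poch big_geq // addn0 Np /pochhammer big_ord0 divr1 mulr1.
have uj : j`!%:R \is a @GRing.unit R by rewrite fact_unit // ltnW.
have nj : ~~ (p %| j.+1)%N by rewrite gtnNdvd.
rewrite /pochhammer big_ord_recr /= -/(pochhammer _ _) factS natrM.
rewrite invrM ?(unit_nat nj) // mulrACA IHj ?(ltnW jp) // pfree_pochS {2}/pfree (negPf nj) /pfree.
have -> : (p %| A + j)%N = ((N + j).+1 == p)%N.
  rewrite /dvdn -modnDml eA modnDml -/(dvdn p _) addSn.
  by apply/idP/eqP => [/dvdnP[[|[|q]] eq]|->//]; nia.
rewrite addnS; case: (ltngtP (N + j).+1 p) => [lt|gt|eq].
- by rewrite !mulr1 natrD.
- by rewrite mulrAC natrD.
have -> : (p.-1 - N = j)%N by lia.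
by rewrite mulr1 mul1r mulrA mulrAC.
Qed.

Lemma e_mul_mul a a' b b' : e * a = e * a' -> e * b = e * b' -> e * (a * b) = e * (a' * b').
Proof. by move=> ea eb; rewrite mulrA ea mulrAC eb -mulrA [b' * _]mulrC. Qed.

(** By [ann_e] the difference [a - a'] is a multiple of e, so y annihilates it. *)
Lemma e_eq_mulr a a' y : e * a = e * a' -> e * y = 0 -> a * y = a' * y.
Proof.
move=> /eqP; rewrite -subr_eq0 -mulrBr => /eqP/ann_e[z az] ey.
by apply/eqP; rewrite -subr_eq0 -mulrBl az mulrAC ey mul0r.
Qed.

(** * Termwise comparison for three parameters *)

Section ThreeArguments.
Variables (n A B C : nat) (u v : R).
Local Notation m := p./2.
Hypotheses (le_nm : (n <= m)%N) (eA : A = n.+1 %[mod p]) (eB : B = m.+1 %[mod p]).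
Hypothesis eC : C = (p.-1 - n).+1 %[mod p].
Hypotheses (Bm : B%:R + m%:R = e * v) (Cn : C%:R + n%:R = e * u).

(* The j-th term of G when A, B, C are the residues of its arguments and C + n is
   divisible by p: the middle case comes from k = 1, and k >= 2 gives multiples
   of p^2. *)
Definition lhs_term j :=
  if (j <= n)%N then (1 + e) * (Q A (j + j * p) * Q B (j + j * p) * Q C (j + j * p))
  else if (j <= m)%N then e * (u + j%:R) * (Q A j * Q B j * Q C j) else 0.

(** The value F(M), needed at [M = j] and at [M = j (1 + p)]. *)
Definition bin3 M : R := ('C(n + M, n) * 'C(m + M, m) * 'C(p.-1 - n + M, p.-1 - n))%:R.

Lemma lhs_term_sub j : (j < p)%N ->
  lhs_term j -
    pochhammer A%:R j / j`!%:R * (pochhammer B%:R j / j`!%:R)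
      * (pochhammer C%:R j / j`!%:R)
  = (1 + e) * bin3 (j + j * p) - bin3 j.
Proof.
move=> jp; have m2 : (m + m).+1 = p.
  by rewrite addnn -add1n -[LHS]/(true + m.*2)%N -p_odd odd_double_half.
have np : (n < p)%N by clear -le_nm m2; lia.
have mp : (m < p)%N by clear -m2; lia.
have Np : (p.-1 - n < p)%N by clear -m2; lia.
rewrite (pochhammer_pfree np jp eA) (pochhammer_pfree mp jp eB) (pochhammer_pfree Np jp eC).
have bj N : (N < p)%N -> 'C(N + j, N)%:R = Q N.+1 j * (if (N + j < p)%N then 1 else e).
  by move=> Nltp; have := natr_bin_pfree 0 Nltp jp; rewrite mul0n addn0 mulr1.
rewrite /bin3 !natrM !bj // !natr_bin_pfree //.
have -> : (p.-1 - n + j < p)%N = (j <= n)%N.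
  by clear -le_nm m2; apply/idP/idP; lia.
have -> : (p.-1 - (p.-1 - n) = n)%N by clear -le_nm m2; lia.
have -> : (m + j < p)%N = (j <= m)%N by clear -m2; apply/idP/idP; lia.
have -> : (p.-1 - m = m)%N by clear -m2; lia.
rewrite Bm Cn /lhs_term.
have eQA := e_pfree_poch_mod _ eA; have eQB := e_pfree_poch_mod _ eB.
have eQC := e_pfree_poch_mod _ eC.
(* For j > m, the factors attached to m and to [p-1-n] both contain a multiple of p, so every term
   is a multiple of p^2. *)
case: (leqP j m) => [jm|mj]; last first.
  rewrite leqNgt (leq_ltn_trans le_nm mj) /=.
  move: (if _ then _ else _) (if _ then _ else _) (if _ then _ else _) => s t w.
  move: (e) ee (Q _ _) (Q _ _) (Q _ _) (Q _ _) (Q _ _) (Q _ _) (Q _ _) (Q _ _) (Q _ _).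
  move=> z zz q1 q2 q3 q4 q5 q6 q7 q8 q9; apply/eqP; rewrite -subr_eq0; apply/eqP.
  transitivity (z * z * (q3 * s * q2 * q1 - q9 * w * q8 * v * q7 * u
    - (1 + z) * (q6 * t * q5 * q4 * j.+1%:R ^+ 2))); last by rewrite zz mul0r.
  by ring.
have -> : (n + j < p)%N by clear -m2 jm le_nm; lia.
have eQ X c : e * Q X (j + c * p) = e * Q X j by apply: e_pfree_poch_addp.
case: (leqP j n) => [jn|nj].
  rewrite !mulr1.
  (* For j <= n no multiple of p occurs. X and its representative [N+1] acquire the same ratio t,
     with t = 1 modulo p. Each side is then a product of three Q's times [(1 + e) a b c - 1], a
     multiple of p, so the Q's matter only modulo p. *)
  have tE X N : X = N.+1 %[mod p] -> exists t, [/\ e * t = e,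
      Q X (j + j * p) = Q X j * t & Q N.+1 (j + j * p) = Q N.+1 j * t].
    move=> eX; exists ((window (X + j) / window j.+1) ^+ j).
    rewrite !pfree_poch_addp (@window_mod (X + j) (N.+1 + j)) -1?modnDml ?eX ?modnDml //.
    split=> //; apply: (mulrI (pfree_poch_unit X j)).
    have := eQ X j; rewrite pfree_poch_addp (@window_mod (X + j) (N.+1 + j)).
      by rewrite mulrCA => ->; rewrite mulrC.
    by rewrite -modnDml eX modnDml.
  have [a [ea -> ->]] := tE _ _ eA; have [b [eb -> ->]] := tE _ _ eB.
  have [c [ec -> ->]] := tE _ _ eC.
  have := @e_eq_mulr _ _ ((1 + e) * (a * b * c) - 1)
     (e_mul_mul (e_mul_mul (eQA j) (eQB j)) (eQC j)).
  have -> : e * ((1 + e) * (a * b * c) - 1) = 0.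
    have eabc : e * (a * b * c) = e by rewrite !mulrA ea eb ec.
    by rewrite mulrBr mulrCA eabc mulrDl ee mul1r addr0 mulr1 subrr.
  move=> /(_ erefl).
  move: (Q n.+1 j) (Q m.+1 j) (Q (p.-1 - n).+1 j) => q4 q5 q6.
  move: (e) (Q A j) (Q B j) (Q C j) => z q1 q2 q3 Hq.
  transitivity (q1 * q2 * q3 * ((1 + z) * (a * b * c) - 1)); first by ring.
  by rewrite Hq; ring.
(* For n < j <= m, only the factor attached to [p-1-n] contains a multiple of p, so all Q's matter
   only modulo p and both sides reduce to [e j] times their product. *)
rewrite !mulr1.
have := e_mul_mul (e_mul_mul (eQA j) (eQB j)) (eQC j).
have := e_mul_mul (e_mul_mul (eQ n.+1 j) (eQ m.+1 j)) (eQ (p.-1 - n).+1 j).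
move: (Q n.+1 _) (Q m.+1 _) (Q (p.-1 - n).+1 _) => q7 q8 q9.
move: (Q n.+1 j) (Q m.+1 j) (Q (p.-1 - n).+1 j) => q4 q5 q6.
move: (e) ee (Q A j) (Q B j) (Q C j) => z zz q1 q2 q3 H1 H2.
transitivity (j%:R * (z * (q1 * q2 * q3))); first by ring.
transitivity (j.+1%:R * (z * (q7 * q8 * q9)) + z * z * (j.+1%:R * (q7 * q8 * q9))
  - z * (q4 * q5 * q6)); last by ring.
by rewrite zz H1 -H2 -natr1; ring.
Qed.

(** The polynomial is the product of [(X + i) / i] for 1 <= i <= N, whose denominators are units
    because N < p. *)
Lemma horner_bin (N : nat) : (N < p)%N ->
  exists2 P : {poly R}, (size P <= N.+1)%N & forall M, P.[M%:R] = 'C(N + M, N)%:R.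
Proof.
elim: N => [|N IHN] Np; first by exists 1 => [|M]; rewrite ?size_poly1 // hornerC bin0.
have [P sP PE] := IHN (ltnW Np).
exists (P * ((N.+1%:R^-1)%:P * ('X + N.+1%:R%:P))) => [|M].
  rewrite (leq_trans (size_polyMleq _ _)) //.
  rewrite mul_polyC; have := size_scale_leq (N.+1%:R^-1 : R) ('X + N.+1%:R%:P).
  rewrite size_XaddC => /(leq_add sP); rewrite addn2; case: (_ + _)%N => //.
rewrite !hornerM PE !hornerE addSn natr_binS ?unit_nat ?gtnNdvd //.
by rewrite /= -mulrA [N.+1%:R^-1 * _]mulrC -natrD addnS [(M + N)%N]addnC.
Qed.

Lemma sum_lhs_term :
  \sum_(0 <= j < p) lhs_term j = \sum_(0 <= j < p)
    (pochhammer A%:R j / j`!%:R * (pochhammer B%:R j / j`!%:R)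
      * (pochhammer C%:R j / j`!%:R)).
Proof.
have m2 : (m + m).+1 = p.
  by rewrite addnn -add1n -[LHS]/(true + m.*2)%N -p_odd odd_double_half.
have [|P1 s1 E1] := @horner_bin n; first by clear -le_nm m2; lia.
have [|P2 s2 E2] := @horner_bin m; first by clear -m2; lia.
have [|P3 s3 E3] := @horner_bin (p.-1 - n); first by clear -m2; lia.
(* The degrees n, m and [p-1-n] add up to [m + p - 1], which is at most [2p - 3]. *)
have sP : (size (P1 * P2 * P3)%R <= p.-1.*2)%N.
  have := size_polyMleq (P1 * P2) P3; have := size_polyMleq P1 P2.
  clear -s1 s2 s3 m2 le_nm p_gt2; lia.
apply/eqP; rewrite -subr_eq0 -sumrB; apply/eqP; rewrite -[RHS](sum_horner_twist sP).
apply: eq_big_nat => j /andP[_ jp]; rewrite lhs_term_sub //.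
have -> : j%:R * (1 + e) = (j + j * p)%:R by rewrite mulrDr mulr1 natrD natrM.
by rewrite !hornerM !E1 !E2 !E3 /bin3 !natrM.
Qed.

End ThreeArguments.
End ModP2.

(** * Rational numbers in rings where their denominators are units *)

Section RatrUnit.
Variable S : comUnitRingType.

Lemma denq_dvd (q : rat) (D : nat) (z : int) :
  D%:R * q = z%:~R -> (denq q %| D%:Z)%Z.
Proof.
rewrite -{1}[q]divq_num_den mulrA => /(canRL (divfK _)) -/(_ _).
rewrite intr_eq0 denq_neq0 => /(_ isT); rewrite -[D%:R]/(D%:~R) -!intrM => /intr_inj e.
have : (denq q %| D%:Z * numq q)%Z by rewrite e dvdz_mull.
by rewrite Gauss_dvdzl // coprimez_sym; apply: coprime_num_den.
Qed.

Lemma denq_unit (q : rat) (D : nat) (z : int) :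
  D%:R \is a @GRing.unit S -> D%:R * q = z%:~R -> (denq q)%:~R \is a @GRing.unit S.
Proof.
move=> uD /denq_dvd /dvdzP[k e]; move: uD.
by rewrite -[D%:R]/(D%:~R) e intrM unitrM => /andP[].
Qed.

Lemma ratr_unitE (q : rat) (D : nat) (z : int) :
  D%:R \is a @GRing.unit S -> D%:R * q = z%:~R -> ratr q * D%:R = z%:~R :> S.
Proof.
move=> uD qz; have uq := denq_unit uD qz.
have /dvdzP[k e] := denq_dvd qz.
have -> : z = numq q * k.
  apply: (@intr_inj rat); rewrite -qz -[D%:R]/(D%:~R) e !intrM -{2}[q]divq_num_den.
  by rewrite mulrAC -mulrA divfK ?intr_eq0 ?denq_neq0 // mulrC.
by rewrite /ratr -[D%:R]/(D%:~R) e !intrM mulrA mulrAC divrK.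
Qed.

(** Over Z_p, [ratr] is not additive on all of [rat]: it respects differences only where
    denominators are invertible. *)
Lemma ratrB_unit (x y : rat) :
  (denq x)%:~R \is a @GRing.unit S -> (denq y)%:~R \is a @GRing.unit S ->
  ratr (x - y) = ratr x - ratr y :> S.
Proof.
move=> ux uy; pose D := absz (denq x * denq y).
have DE : D = denq x * denq y :> int by rewrite gez0_abs // mulr_ge0 ?denq_ge0.
have uD : D%:R \is a @GRing.unit S.
  by rewrite -[D%:R]/(D%:~R) DE intrM unitrM ux.
have /(ratr_unitE uD) : D%:R * (x - y) = (numq x * denq y - numq y * denq x)%:~R.
  rewrite -[D%:R]/(D%:~R) DE intrB !intrM !numqE; ring.
move/(canRL (mulrK uD)) ->; rewrite /ratr -[D%:R]/(D%:~R) DE !intrM intrB !intrM.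
rewrite invrM // mulrBl !mulrA; congr (_ - _).
  by rewrite mulrK.
by rewrite mulrAC mulrK.
Qed.

End RatrUnit.

(** * Reduction from Z_p to Z/p^(k+1) *)

Lemma Zp_pow2_ann (p : nat) (x : 'Z_(p ^ 2)) : prime p ->
  p%:R * x = 0 -> exists y, x = p%:R * y.
Proof.
move=> p_prime; have p_gt1 := prime_gt1 p_prime.
have p2_gt1 : (1 < p ^ 2)%N by rewrite (ltn_trans p_gt1) // -{1}(expn1 p) ltn_exp2l.
rewrite -[x]natr_Zp -natrM => /(congr1 val) /=; rewrite val_Zp_nat // => /eqP.
move=> /dvdnP[k e]; exists k%:R; rewrite -natrM; congr _%:R.
move: (nat_of_ord x) e => y; rewrite -mulnn mulnA [(k * p)%N]mulnC => /eqP.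
by rewrite mulnC eqn_pmul2r ?prime_gt0 // => /eqP.
Qed.

(** A separate name for the projection lets it carry a ring morphism structure; [simpl never] keeps
    it folded. *)
Definition padic_ev (p k : nat) (x : padic_int p) : 'Z_(p ^ k.+1) := x k.
Arguments padic_ev : simpl never.

Section PadicResidues.
Variables (p : nat) (k : nat).
Hypothesis p_prime : prime p.

Local Notation padic_ev := (@padic_ev p k).

Let p_gt1 : (1 < p)%N. Proof. exact: prime_gt1. Qed.
Let pn_gt1 n : (1 < p ^ n.+1)%N.
Proof. by rewrite -{1}(expn0 p) ltn_exp2l. Qed.

Lemma padic_ev_is_zmod_morphism : zmod_morphism padic_ev.
Proof. by []. Qed.

Lemma padic_ev_is_monoid_morphism : monoid_morphism padic_ev.
Proof. by []. Qed.

HB.instance Definition _ := GRing.isZmodMorphism.Build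
  (padic_int p) 'Z_(p ^ k.+1) padic_ev padic_ev_is_zmod_morphism.
HB.instance Definition _ := GRing.isMonoidMorphism.Build
  (padic_int p) 'Z_(p ^ k.+1) padic_ev padic_ev_is_monoid_morphism.

Lemma Zp_unit_nat i : ~~ (p %| i)%N -> i%:R \is a @GRing.unit 'Z_(p ^ k.+1).
Proof. by move=> pi; rewrite unitZpE // coprime_pexpl // prime_coprime. Qed.

Lemma padic_unitP (x : padic_int p) :
  (forall n, x n \is a GRing.unit) -> x \is a GRing.unit.
Proof. by move=> ux; apply/asboolP. Qed.

Lemma padic_unit_nat i : ~~ (p %| i)%N -> i%:R \is a @GRing.unit (padic_int p).
Proof.
move=> pi; apply: padic_unitP => n.
by rewrite padic_res_nat unitZpE // coprime_pexpl // prime_coprime.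
Qed.

(** Continuity replaces x by a natural number, and on natural numbers the residue of gamma is
    periodic by [morita_gamma_res_mod]. *)
Lemma morita_gamma_ev (x : padic_int p) (i : nat) : odd p ->
  padic_ev x = i%:R -> padic_ev (morita_gamma x) = padic_ev (morita_gamma_nat p i).
Proof.
move=> p_odd xi; have [gC gN] := morita_gammaP p_prime p_odd.
have [|l _ gl] := gC x [set z : padic_int p | padic_ev z = padic_ev (morita_gamma x)]%classic.
  by exists k.
(* The level is high enough both for continuity (l) and for y to agree with i modulo p^(k+1) (k). *)
pose y : padic_int p := (x (maxn k l) : nat)%:R.
have ey : y (maxn k l) = x (maxn k l) by rewrite padic_res_nat natr_Zp.
rewrite -(gl y) /=; last by rewrite (padic_res_le _ ey) ?leq_maxr.
rewrite gN /padic_ev -[RHS]morita_gamma_res_mod // -[LHS]morita_gamma_res_mod //.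
rewrite -padic_res_mod ?leq_maxl // -val_Zp_nat //.
by rewrite -[x k]/(padic_ev x) xi.
Qed.

Lemma morita_gamma_nat_unit i : morita_gamma_nat p i \is a GRing.unit.
Proof.
rewrite unitrMl ?unitrX ?unitrN1 //.
by apply: rpred_prod => j; apply: padic_unit_nat.
Qed.

Lemma Zpow_red_unit n (z : 'Z_(p ^ n.+2)) : Zpow_red z \is a GRing.unit -> z \is a GRing.unit.
Proof.
rewrite -[z]natr_Zp Zpow_red_nat !unitZpE //.
by rewrite !coprime_pexpl.
Qed.

(** Invertibility is decided modulo p: any level reduces to level 0, and units lift from there. *)
Lemma padic_unit_ev (x : padic_int p) n : x n \is a GRing.unit -> x \is a GRing.unit.
Proof.
move=> ux; apply: padic_unitP => i.
suff x0 : x 0 \is a GRing.unit.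
  by elim: i => [//|i IHi]; apply: Zpow_red_unit; rewrite padic_resP.
elim: n ux => [//|n IHn] ux; apply: IHn; rewrite -padic_resP.
exact: (rmorph_unit (@Zpow_red p n)).
Qed.

Lemma morita_gamma_natD a M :
  padic_ev (morita_gamma_nat p (a + M)) = padic_ev (morita_gamma_nat p a)
    * ((-1) ^+ M * \prod_(0 <= i < M) pfree p 'Z_(p ^ k.+1) (a + i)).
Proof.
rewrite /padic_ev !morita_gamma_res exprD -!mulrA; congr (_ * _).
rewrite [RHS]mulrCA; congr (_ * _).
rewrite (@big_cat_nat _ _ _ a) ?leq_addr //=; congr (_ * _).
rewrite big_mkcond (big_nat_translate _ _ _ a); apply: eq_bigr => i _.
by rewrite /pfree; case: (p %| a + i)%N.
Qed.

End PadicResidues.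

(** * Morita's gamma function modulo p^2 *)

Section GammaModP2.
Variable p : nat.
Hypotheses (p_prime : prime p) (p_odd : odd p).
Local Notation R := 'Z_(p ^ 2).
Local Notation ev := (@padic_ev p 1).
Local Notation e := (@GRing.natmul R 1 p).
Local Notation Q := (pfree_poch p R).

Let p_gt1 : (1 < p)%N. Proof. exact: prime_gt1. Qed.

Let p2_gt1 : (1 < p ^ 2)%N.
Proof. by rewrite (ltn_trans p_gt1) // -{1}(expn1 p) ltn_exp2l. Qed.

Let p2_eq0 : (p ^ 2)%:R = 0 :> R. Proof. exact: pchar_Zp. Qed.

Let ee : e * e = 0. Proof. by rewrite -natrM mulnn. Qed.

Let unitR := @Zp_unit_nat p 1 p_prime.

Lemma twist_even j : odd (j + j * p) = false.
Proof. by rewrite oddD oddM p_odd andbT addbb. Qed.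

Lemma twist_lt j : (j < p)%N -> (j + j * p < p ^ 2)%N.
Proof. clear p_odd; by move=> jp; rewrite -mulnn; nia. Qed.

Lemma morita_gamma_nat_ratio a j :
  ev (morita_gamma_nat p (a + (j + j * p)))
    = ev (morita_gamma_nat p a) * \prod_(0 <= i < j + j * p) pfree p R (a + i).
Proof. by rewrite morita_gamma_natD // -signr_odd twist_even mul1r. Qed.

(** With M = j(p+1), gamma at p^2 agrees with gamma at 0, which is 1. Of the M factors leading from
    [p^2 - M] to p^2, those prime to p have the form [p^2 - i = -i]. *)
Lemma morita_gamma_nat_reflect j : (j < p)%N ->
  ev (morita_gamma_nat p (p ^ 2 - (j + j * p)))
    * ((-1) ^+ j * \prod_(0 <= i < j + j * p) pfree p R i.+1) = 1.
Proof.
move=> jp; have ltM := twist_lt jp.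
transitivity (ev (morita_gamma_nat p (p ^ 2))); last first.
  rewrite /padic_ev -morita_gamma_res_mod // modnn /morita_gamma_nat big_geq //.
  by rewrite expr0 mulr1.
have -> : morita_gamma_nat p (p ^ 2) = morita_gamma_nat p (p ^ 2 - (j + j * p) + (j + j * p)).
  by rewrite subnK // ltnW.
rewrite morita_gamma_nat_ratio; congr (_ * _).
rewrite [RHS]big_nat_rev /= add0n.
transitivity (\prod_(0 <= i < j + j * p)
    ((if (p %| i.+1)%N then 1 else -1) * pfree p R i.+1)).
  rewrite big_split /=; congr (_ * _).
  (* The sign counts the integers up to M prime to p, of which there are [M - j] as floor(M/p) = j;
     M is even. *)
  rewrite -(signr_odd _ j) (_ : odd j = odd ((j + j * p) + (j + j * p) %/ p)); last first.
    by rewrite oddD twist_even addnC divnMDl ?divn_small ?addn0 ?prime_gt0.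
  rewrite signr_odd; elim: (j + j * p)%N => [|q IHq]; first by rewrite big_geq // div0n.
  rewrite big_nat_recr //= -IHq divnS ?prime_gt0 //.
  by case: ifP => _; rewrite ?add0n ?add1n ?addnS ?addSn !exprS; ring.
apply: eq_big_nat => i /andP[_ iM].
have -> : (p ^ 2 - (j + j * p) + (j + j * p - i.+1) = p ^ 2 - i.+1)%N by lia.
rewrite /pfree dvdn_subr ?dvdn_exp //; last by lia.
case: ifP => _; rewrite ?mulr1 // natrB; last by lia.
by rewrite p2_eq0 sub0r mulN1r.
Qed.

(** The cube of gamma at [-M] supplies the denominators of the three Q's, and its sign [(-1)^(3j)]
    cancels the one from the Teichmüller character. *)
Lemma gamma_term A1 A2 A3 j : (j < p)%N ->
  let g a := ev (morita_gamma_nat p a) in let M := (j + j * p)%N in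
  (-1) ^+ (j * 3) * g (p ^ 2 - M)%N ^+ 3 *
    (g (A1 + M)%N / g A1 * (g (A2 + M)%N / g A2) * (g (A3 + M)%N / g A3))
  = Q A1 M * Q A2 M * Q A3 M.
Proof.
move=> jp g M.
have gU a : g a \is a GRing.unit by apply/rmorph_unit/morita_gamma_nat_unit.
have HU : \prod_(0 <= i < M) pfree p R i.+1 \is a GRing.unit.
  by apply: rpred_prod => *; apply: pfree_unit.
have -> : g (p ^ 2 - M)%N = (-1) ^+ j / \prod_(0 <= i < M) pfree p R i.+1.
  apply: (mulIr HU); rewrite divrK //.
  have := morita_gamma_nat_reflect jp; rewrite -/M -/(g _) => h.
  rewrite -[RHS]mulr1; transitivity ((-1) ^+ j * (g (p ^ 2 - M)%N *
    ((-1) ^+ j * \prod_(0 <= i < M) pfree p R i.+1))); last by rewrite h.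
  by rewrite [RHS]mulrCA [(-1) ^+ j * (_ * _)]mulrA -expr2 sqrr_sign mul1r.
have gM a : g (a + M)%N / g a = \prod_(0 <= i < M) pfree p R (a + i).
  by rewrite /g morita_gamma_nat_ratio mulrAC (divrr (gU a)) mul1r.
rewrite !gM !(pfree_poch_quot unitR) exprM.
have := sqrr_sign R j; set s : R := (-1) ^+ j.
move: s (\prod_(0 <= i < M) pfree p R i.+1)^-1 (\prod_(0 <= i < M) pfree p R (A1 + i))
  (\prod_(0 <= i < M) pfree p R (A2 + i)) (\prod_(0 <= i < M) pfree p R (A3 + i)).
move=> s x y z t ss; transitivity ((s ^+ 2) ^+ 3 * (y * x * (z * x) * (t * x))).
  by ring.
by rewrite ss expr1n mul1r.
Qed.

End GammaModP2.

(** * Residues of both sides modulo p^2 *)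

Section HypergeometricResidue.
Variable p : nat.
Hypotheses (p_prime : prime p) (p_odd : odd p).
Local Notation R := 'Z_(p ^ 2).
Local Notation ev := (@padic_ev p 1).
Local Notation e := (@GRing.natmul R 1 p).
Local Notation Q := (pfree_poch p R).

Lemma ev_hypergeometric_trunc (x1 x2 x3 : padic_int p) (A1 A2 A3 : nat) :
  ev x1 = A1%:R -> ev x2 = A2%:R -> ev x3 = A3%:R ->
  ev (hypergeometric_trunc [:: x1; x2; x3] [:: 1; 1] 1 p.-1) =
  \sum_(0 <= j < p) (pochhammer A1%:R j / j`!%:R * (pochhammer A2%:R j / j`!%:R)
      * (pochhammer A3%:R j / j`!%:R)).
Proof.
move=> e1 e2 e3.
rewrite /hypergeometric_trunc prednK ?prime_gt0 // rmorph_sum big_mkord /=.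
apply: eq_bigr => -[j jp] _ /=; rewrite !big_cons !big_nil !mulr1 expr1n.
have evP x a : ev x = a%:R -> ev (pochhammer x j) = pochhammer a%:R j.
  move=> ex; rewrite /pochhammer rmorph_prod; apply: eq_bigr => i _.
  by rewrite rmorphD /= ex rmorph_nat.
have p1 : pochhammer (1 : padic_int p) j = j`!%:R.
  rewrite /pochhammer; elim: j {jp evP} => [|j IHj]; first by rewrite big_ord0.
  by rewrite big_ord_recr /= IHj factS mulnC natrM nat1r.
have uj : j`!%:R \is a @GRing.unit (padic_int p).
  apply: padic_unit_ev p_prime _ 0 _; rewrite padic_res_nat.
  exact: (fact_unit (@Zp_unit_nat p 0 p_prime) jp).
have uR := rmorph_unit ev uj; rewrite rmorph_nat in uR.
have jV : ev j`!%:R^-1 = j`!%:R^-1 by rewrite (rmorphV ev uj) rmorph_nat.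
rewrite p1 mul1r invrM // !rmorphM /= !jV (evP _ _ e1) (evP _ _ e2) (evP _ _ e3).
by move: (pochhammer _ j) (pochhammer _ j) (pochhammer _ j) (_^-1) => *; ring.
Qed.

(** The value w satisfies [(w - 1) (w + 1) = 0], and [w - 1] is -2 modulo p, a unit since p is
    odd. *)
Lemma teichmullerN1 : teichmuller (-1 : 'F_p) = -1 :> padic_int p.
Proof.
have [_ w1 wM wc] := teichmullerP p_prime.
set w := teichmuller (-1); have ww : w * w = 1 by rewrite -wM mulrNN mulr1 w1.
have : (w - 1) * (w + 1) = 0 by rewrite mulrDr mulrBl ww mul1r mulr1 subrKA subrr.
have /padic_congP w0 := wc (-1).
have p_gt2 : (2 < p)%N := odd_prime_gt2 p_odd p_prime.
have uw : w - 1 \is a GRing.unit.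
  apply: (padic_unit_ev p_prime (n := 0)); rewrite /= w0 // padic_res_nat.
  have -> : nat_of_ord (-1 : 'F_p) = p.-1.
    have -> : -1 = p.-1%:R :> 'F_p.
      by rewrite -subn1 natrB ?prime_gt0 // pchar_Fp_0 // sub0r.
    by rewrite val_Fp_nat // modn_small //; lia.
  rewrite -[1]/(1%:R) -natrB; last by lia.
  by apply: Zp_unit_nat => //; rewrite gtnNdvd //; lia.
by rewrite -(mulr0 (w - 1)) => /(mulrI uw)/eqP; rewrite addr_eq0 => /eqP.
Qed.

Let ee : e * e = 0.
Proof.
by rewrite -natrM mulnn pchar_Zp // -{1}(expn0 p) ltn_exp2l ?prime_gt1.
Qed.

Let evp1 : ev p.-1%:R = e - 1.
Proof. by rewrite rmorph_nat -subn1 natrB ?prime_gt0. Qed.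

Let p1_unit : p.-1%:R \is a @GRing.unit (padic_int p).
Proof.
have := odd_prime_gt2 p_odd p_prime.
by move=> p_gt2; rewrite padic_unit_nat // gtnNdvd //; lia.
Qed.

(** The inverse of [p - 1] is [-(1 + p)], since [(p - 1)(p + 1) = -1] modulo p^2. *)
Let e1_inv (x y : R) : x * (e - 1) = y -> x = - (y * (1 + e)).
Proof.
move=> <-; rewrite -mulrA (_ : (e - 1) * (1 + e) = -1) ?mulrN1 ?opprK //.
by rewrite mulrDr mulr1 mulrBl ee mul1r sub0r addrAC subrr sub0r.
Qed.

Lemma ev_ratr_twist j : ev (ratr (j%:R / p.-1%:R)) = - (j + j * p)%:R.
Proof.
have qE : p.-1%:R * (j%:R / p.-1%:R) = j%:~R :> rat.
  rewrite mulrC divfK // pnatr_eq0; have := odd_prime_gt2 p_odd p_prime; lia.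
have /(congr1 ev) := ratr_unitE p1_unit qE; rewrite rmorphM /= evp1 rmorph_int.
by move/e1_inv->; rewrite mulrDr mulr1 natrD natrM.
Qed.

Section Terms.
Variables (x : rat) (A : nat).
Hypotheses (ux : (denq x)%:~R \is a @GRing.unit (padic_int p)).
Hypothesis evx : ev (ratr x) = A%:R.

Let denq_twist j (i : nat) : (denq (j%:R / p.-1%:R - i%:R))%:~R \is a @GRing.unit (padic_int p).
Proof.
apply: (denq_unit (z := j%:Z - i%:Z * p.-1%:Z) p1_unit).
rewrite intrB intrM mulrBr mulrC divfK ?[p.-1%:R * _]mulrC //.
by rewrite pnatr_eq0; have := odd_prime_gt2 p_odd p_prime; lia.
Qed.

(** The integer i treats together the arguments [x - j/(p-1)] (i = 0) and [1 + x - j/(p-1)] (i =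
    1). *)
Lemma ev_ratr_sub_twist j (i : nat) :
  ev (ratr (x - (j%:R / p.-1%:R - i%:R))) = (A + i + (j + j * p))%:R.
Proof.
have ui : (denq i%:R)%:~R \is a @GRing.unit (padic_int p).
  by rewrite -[i%:R]/(i%:~R) denq_int unitr1.
have u0 : (denq (j%:R / p.-1%:R))%:~R \is a @GRing.unit (padic_int p).
  by rewrite -[_ / _]subr0 -[0]/(0%:R); apply: denq_twist.
rewrite !ratrB_unit // !rmorphB /= evx ev_ratr_twist ratr_nat rmorph_nat.
by rewrite !natrD !natrM; ring.
Qed.

End Terms.

Lemma ev_padic_hypergeometric3 (args : seq rat) (x1 x2 x3 : rat)
    (n m A1 A2 A3 : nat) :
  sort <=%R args = [:: x1; x2; x3] ->
  Num.floor (x1 * p.-1%:R) = n%:Z -> Num.floor (x2 * p.-1%:R) = m%:Z ->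
  (n <= m < p)%N ->
  (denq x1)%:~R \is a @GRing.unit (padic_int p) ->
  (denq x2)%:~R \is a @GRing.unit (padic_int p) ->
  (denq x3)%:~R \is a @GRing.unit (padic_int p) ->
  ev (ratr x1) = A1%:R -> ev (ratr x2) = A2%:R -> ev (ratr x3) = A3%:R ->
  ev (padic_hypergeometric p args) = (1 + e) *
    (\sum_(0 <= j < n.+1) Q A1 (j + j * p) * Q A2 (j + j * p) * Q A3 (j + j * p)
     + e * \sum_(n.+1 <= j < m.+1) pfree p R (A1 + (j + j * p)) *
       (Q A1 (j + j * p) * Q A2 (j + j * p) * Q A3 (j + j * p))).
Proof.
move=> sE f1 f2 /andP[nm mp] u1 u2 u3 e1 e2 e3.
have pf : ev (- 1 / p.-1%:R) = 1 + e.
  rewrite mulN1r rmorphN /=; have : ev (p.-1%:R^-1) * (e - 1) = 1.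
    by rewrite -evp1 -(rmorphM ev) mulVr // rmorph1.
  by move/e1_inv->; rewrite mul1r opprK.
have p_gt2 : (2 < p)%N := odd_prime_gt2 p_odd p_prime.
(* As [a 0 = -1/(p-1)], the floor is -1 and the summation starts at j = 0. *)
have b0 : absz (Num.floor (- (p.-1%:R^-1) * p.-1%:R : rat) + 1) = 0%N.
  rewrite mulNr mulVf; last by rewrite pnatr_eq0; lia.
  by rewrite -[-1]/((-1)%:~R) intrKfloor.
rewrite /padic_hypergeometric [sort _ _]sE rmorphM /= pf; congr (_ * _).
(* The blocks k >= 2 carry p^2; only j <= n (k = 0) and n < j <= m (k = 1) remain. *)
have evp2 k (X : padic_int p) : ev ((- p%:R) ^+ k.+2 * X) = 0.
  by rewrite rmorphM rmorphXn /= rmorphN rmorph_nat !exprS mulrA mulrNN ee !mul0r.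
rewrite rmorph_sum (@big_ltn _ _ _ 0 4) // (@big_ltn _ _ _ 1 4) //.
rewrite (@big_ltn _ _ _ 2 4) // (@big_ltn _ _ _ 3 4) // (@big_geq _ _ _ 4 4) //=.
rewrite !evp2 !addr0 b0 f1 f2.
have absS (i : nat) : absz (i%:Z + 1) = i.+1 by rewrite -[1]/(1%:Z) -PoszD absz_nat addn1.
rewrite !absS expr0 expr1 mul1r rmorphM rmorphN rmorph_nat /= mulNr -mulrN.
have gE (q : rat) (a : nat) : ev (ratr q) = a%:R ->
    ev (morita_gamma (ratr q)) = ev (morita_gamma_nat p a).
  exact: morita_gamma_ev.
have gV (q : rat) (a : nat) : ev (ratr q) = a%:R ->
    ev (morita_gamma (ratr q))^-1 = (ev (morita_gamma_nat p a))^-1.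
  move=> /gE qa; have uq : morita_gamma (ratr q) \is a @GRing.unit (padic_int p).
    apply: (@padic_unit_ev p p_prime _ 1); rewrite -[X in X \is a _]/(ev _) qa.
    exact/(rmorph_unit ev)/morita_gamma_nat_unit.
  by rewrite (rmorphV ev uq) /= qa.
have gdiv (x : rat) (a i : nat) j : (denq x)%:~R \is a @GRing.unit (padic_int p) ->
    ev (ratr x) = a%:R ->
    ev (morita_gamma (ratr (x - (j%:R / p.-1%:R - i%:R))) / morita_gamma (ratr x))
      = ev (morita_gamma_nat p (a + i + (j + j * p))) / ev (morita_gamma_nat p a).
  move=> ux ex; rewrite rmorphM /= (gV _ _ ex); congr (_ / _).
  by apply: gE; apply: ev_ratr_sub_twist.
have g0 j : (j < p)%N -> ev (morita_gamma (ratr (j%:R / p.-1%:R)))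
    = ev (morita_gamma_nat p (p ^ 2 - (j + j * p))).
  move=> jp; have leM := ltnW (twist_lt p_prime jp).
  apply: gE; rewrite ev_ratr_twist natrB //.
  by rewrite pchar_Zp ?sub0r // -{1}(expn0 p) ltn_exp2l ?prime_gt1.
have gdiv0 (x : rat) (a : nat) j : (denq x)%:~R \is a @GRing.unit (padic_int p) ->
    ev (ratr x) = a%:R ->
    ev (morita_gamma (ratr (x - j%:R / p.-1%:R)) / morita_gamma (ratr x))
      = ev (morita_gamma_nat p (a + (j + j * p))) / ev (morita_gamma_nat p a).
  by move=> ux ex; have := gdiv x a 0%N j ux ex; rewrite subr0 addn0.
have gdiv1 (x : rat) (a : nat) j : (denq x)%:~R \is a @GRing.unit (padic_int p) ->
    ev (ratr x) = a%:R ->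
    ev (morita_gamma (ratr (1 + x - j%:R / p.-1%:R)) / morita_gamma (ratr x))
      = - pfree p R (a + (j + j * p))
        * (ev (morita_gamma_nat p (a + (j + j * p))) / ev (morita_gamma_nat p a)).
  move=> ux ex; have := gdiv x a 1%N j ux ex.
  rewrite opprB addrA [x + _]addrC => ->.
  (* One step of the functional equation of gamma produces [-pfree]; its sign later cancels that of
     [-p] in the block k = 1. *)
  rewrite addn1 addSn -[(a + _).+1]addn1 morita_gamma_natD // big_nat1 addn0 expr1.
  by rewrite mulN1r [RHS]mulrA [in RHS]mulrC [- _ * _]mulrC mulrC.
have evT w g a b c : ev (w * g ^+ 3 * (a * (b * c))) = ev w * ev g ^+ 3 * (ev a * ev b * ev c).
  rewrite (rmorphM ev (w * _)) (rmorphM ev w) (rmorphM ev a) (rmorphM ev b).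
  by rewrite (rmorphXn ev) /= !mulrA.
have evw j : ev (teichmuller (-1 : 'F_p) ^+ (j * 3)) = (-1) ^+ (j * 3).
  by rewrite teichmullerN1 rmorphXn rmorphN rmorph1.
rewrite !(rmorph_sum ev) -sumrN; congr (_ + _ * _).
  apply: eq_big_nat => j /andP[_ jn]; have jp : (j < p)%N by clear -jn nm mp; lia.
  rewrite -(gamma_term p_prime p_odd _ _ _ jp) (@big_geq _ _ _ 1 1) // mulr1.
  rewrite (@big_ltn _ _ _ 1 4) // (@big_ltn _ _ _ 2 4) // (@big_ltn _ _ _ 3 4) //.
  by rewrite big_geq // mulr1 /= evT evw (g0 _ jp) (gdiv0 _ _ _ u1 e1)
    (gdiv0 _ _ _ u2 e2) (gdiv0 _ _ _ u3 e3).
apply: eq_big_nat => j /andP[_ jm]; have jp : (j < p)%N by clear -jm mp; lia.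
rewrite -(gamma_term p_prime p_odd _ _ _ jp).
rewrite (@big_ltn _ _ _ 2 4) // (@big_ltn _ _ _ 3 4) // (@big_ltn _ _ _ 1 2) //.
rewrite (@big_geq _ _ _ 4 4) // (@big_geq _ _ _ 2 2) // !mulr1 /=.
rewrite -mulrA [_ / _ * (_ / _) * _]mulrC evT evw (g0 _ jp) (gdiv1 _ _ _ u1 e1)
    (gdiv0 _ _ _ u2 e2) (gdiv0 _ _ _ u3 e3).
move: (pfree _ _ _) (ev _ / ev _) (ev _ / ev _) (ev _ / ev _) => x y z t.
by rewrite !mulNr mulrN opprK [RHS]mulrCA !mulrA.
Qed.

End HypergeometricResidue.

(** * Arithmetic of d and of the three arguments *)

(** Otherwise 1, q mod d and d - 1 would be three distinct residues prime to d. *)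
Lemma totient_le2_coprime (d q : nat) : (1 < d)%N -> (totient d <= 2)%N ->
  coprime d q -> (q %% d = 1)%N \/ (q %% d = d.-1)%N.
Proof.
move=> d_gt1 tot2 cdq; pose r := (q %% d)%N.
have rd : (r < d)%N by rewrite ltn_mod ltnW.
case: (eqVneq r 1%N) => [|r1]; [by left|]; case: (eqVneq r d.-1) => [|r2]; [by right|].
have d_gt2 : (d != 2)%N.
  apply: contra_eqN r1 => /eqP d2; move: cdq; rewrite /r d2 coprime2n modn2.
  by case: odd.
suff : (3 <= totient d)%N by rewrite ltnNge tot2.
have -> : totient d = size [seq i <- iota 0 d | coprime d i].
  rewrite totient_count_coprime size_filter -sum1_count [RHS]big_mkcond /index_iota subn0.
  by apply: eq_bigr => i _; case: coprime.
apply: (@uniq_leq_size _ [:: 1%N; r; d.-1]).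
  by rewrite /= !inE negb_or; lia.
move=> i; rewrite !inE mem_filter mem_iota.
case/or3P => /eqP->; rewrite ?coprimen1 ?coprime_modr ?cdq ?coprimenP //=; lia.
Qed.

Lemma floor_divn (a d : nat) : (0 < d)%N -> Num.floor (1 / d%:R * a%:R : rat) = (a %/ d)%N%:Z.
Proof.
move=> d_gt0; apply: floor_def; rewrite mul1r mulrC.
have d0 : 0 < d%:R :> rat by rewrite ltr0n.
rewrite ler_pdivlMr // ltr_pdivrMr // -[d%:R]/(d%:~R) -[a%:R]/(a%:~R) -!intrM ler_int ltr_int.
by have := divn_eq a d; have := ltn_pmod a d_gt0; nia.
Qed.

Lemma sort_args (d : nat) : (1 < d)%N ->
  sort <=%R [:: 1 / 2; 1 / d%:R; 1 - 1 / d%:R : rat] = [:: 1 / d%:R; 1 / 2; 1 - 1 / d%:R].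
Proof.
move=> d_gt1; have d0 : 0 < d%:R :> rat by rewrite ltr0n ltnW.
have le12 : 1 / d%:R <= 1 / 2 :> rat.
  by rewrite !mul1r lef_pV2 ?posrE ?d0 ?ltr0n // ler_nat.
transitivity (sort <=%R [:: 1 / d%:R; 1 / 2; 1 - 1 / d%:R : rat]).
  apply/perm_sort_leP; apply/permP => P /=; lia.
by apply: sort_le_id; rewrite /= le12 /=; lra.
Qed.

Lemma Zp_pow2_mod (p X Y : nat) (z : 'Z_(p ^ 2)) : prime p ->
  X%:R = Y%:R + p%:R * z -> X = Y %[mod p].
Proof.
move=> p_prime; have p2_gt1 : (1 < p ^ 2)%N by rewrite -{1}(expn0 p) ltn_exp2l ?prime_gt1.
rewrite -[z]natr_Zp -natrM -natrD => /(congr1 val) /=; rewrite !val_Zp_nat // => e.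
have : (X %% p ^ 2 %% p = (Y + p * z) %% p ^ 2 %% p)%N by rewrite e.
by rewrite !modn_dvdm ?dvdn_exp // mulnC addnC modnMDl.
Qed.

Lemma odd_eq_half (p : nat) : odd p -> p = (2 * p./2 + 1)%N.
Proof. by move=> p_odd; rewrite -{1}(odd_double_half p) p_odd mul2n addnC. Qed.

(** * The congruence for 1/2, 1/d and 1 - 1/d *)

Section Supercongruence.
Variables (p d : nat).
Hypotheses (p_prime : prime p) (p_odd : odd p).
Hypotheses (d_gt1 : (1 < d)%N) (d_ltp : (d < p)%N) (d_totient : (totient d <= 2)%N).
Local Notation R := 'Z_(p ^ 2).
Local Notation ev := (@padic_ev p 1).
Local Notation e := (@GRing.natmul R 1 p).
Local Notation Q := (pfree_poch p R).
Local Notation n := (p.-1 %/ d)%N.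
Local Notation m := p./2.

Let p2_gt1 : (1 < p ^ 2)%N.
Proof. by rewrite -{1}(expn0 p) ltn_exp2l ?prime_gt1. Qed.

Let ee : e * e = 0. Proof. by rewrite -natrM mulnn pchar_Zp. Qed.

Let unitR := @Zp_unit_nat p 1 p_prime.
Let annR := fun x => @Zp_pow2_ann p x p_prime.

(** In the middle range the factor e allows [j + j p] to be replaced by j. The choice [u = A1] fits
    because p/d is the value of [C + n] for the parameter C congruent to -n. *)
Lemma sum_lhs_termE (A1 A2 A3 : nat) :
  (n <= m)%N ->
  (forall j, (n < j <= m)%N -> ~~ (p %| A1 + j)%N) ->
  (1 + e) * (\sum_(0 <= j < n.+1) Q A1 (j + j * p) * Q A2 (j + j * p) * Q A3 (j + j * p)
     + e * \sum_(n.+1 <= j < m.+1) pfree p R (A1 + (j + j * p)) *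
       (Q A1 (j + j * p) * Q A2 (j + j * p) * Q A3 (j + j * p)))
  = \sum_(0 <= j < p) lhs_term p n A1 A2 A3 (A1%:R : R) j.
Proof.
move=> nm A1j; have p2 := odd_eq_half p_odd; have := prime_gt1 p_prime => p_gt1.
have mp : (m.+1 <= p)%N by lia.
rewrite [RHS](@big_cat_nat _ _ _ m.+1) //= [X in _ = _ + X]big_nat_cond.
rewrite [X in _ = _ + X]big1; last first.
  move=> j /andP[/andP[mj _] _]; rewrite /lhs_term leqNgt (leq_ltn_trans nm mj) /=.
  by rewrite leqNgt mj.
rewrite addr0 [RHS](@big_cat_nat _ _ _ n.+1) //= mulrDr; congr (_ + _).
  by rewrite mulr_sumr; apply: eq_big_nat => j /andP[_ jn]; rewrite /lhs_term -ltnS jn.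
rewrite mulrA mulrDl ee mul1r addr0 mulr_sumr; apply: eq_big_nat => j /andP[nj jm].
rewrite /lhs_term leqNgt nj -ltnS jm /=.
have nA : ~~ (p %| A1 + (j + j * p))%N.
  by rewrite addnA dvdn_addl ?dvdn_mull // A1j // nj.
rewrite {1}/pfree (negPf nA).
have eQ X : e * Q X (j + j * p) = e * Q X j by apply: e_pfree_poch_addp.
rewrite mulrCA [e * _](e_mul_mul (e_mul_mul (eQ A1) (eQ A2)) (eQ A3)) [LHS]mulrA.
congr (_ * _); rewrite !natrD natrM mulrC !mulrDr [e * (_ * _)]mulrCA ee mulr0.
by rewrite addr0.
Qed.

Lemma ev_ratr_mul (q : rat) (k : nat) (z : int) : ~~ (p %| k)%N ->
  k%:R * q = z%:~R -> ev (ratr q) * k%:R = z%:~R.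
Proof.
move=> pk qz; have uk := padic_unit_nat p_prime pk.
by have /(congr1 ev) := ratr_unitE uk qz; rewrite rmorphM /= rmorph_nat rmorph_int.
Qed.

Lemma padic_hypergeometric_cong2 :
  ev (padic_hypergeometric p [:: 1 / 2; 1 / d%:R; 1 - 1 / d%:R]) =
  ev (hypergeometric_trunc
       [:: ratr (1 / 2); ratr (1 / d%:R); ratr (1 - 1 / d%:R)] [:: 1; 1] 1 p.-1).
Proof.
have p2 := odd_eq_half p_odd; have p_gt2 := odd_prime_gt2 p_odd p_prime.
have d_gt0 : (0 < d)%N by apply: ltnW.
have pd : ~~ (p %| d)%N by rewrite gtnNdvd.
have p_2 : ~~ (p %| 2)%N by rewrite gtnNdvd.
have dE : d%:R * (1 / d%:R) = 1%:~R :> rat.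
  by rewrite mul1r divff // pnatr_eq0 -lt0n.
have dE' : d%:R * (1 - 1 / d%:R) = (d%:Z - 1)%:~R :> rat.
  by rewrite mulrBr dE mulr1 intrB.
have twoE : 2%:R * (1 / 2) = 1%:~R :> rat by [].
have ud := denq_unit (padic_unit_nat p_prime pd) dE.
have ud' := denq_unit (padic_unit_nat p_prime pd) dE'.
have u2 := denq_unit (padic_unit_nat p_prime p_2) twoE.
have valE (q : rat) : ev (ratr q) = (ev (ratr q) : nat)%:R by rewrite natr_Zp.
move: (valE (1 / d%:R)) (valE (1 / 2)) (valE (1 - 1 / d%:R)).
(* A1, A2, A3 represent 1/d, 1/2 and 1 - 1/d modulo p^2. *)
move: (nat_of_ord _) (nat_of_ord _) (nat_of_ord _) => A3 A2 A1 E1 E2 E3.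
have n_le_m : (n <= m)%N.
  have := @leq_div2l p.-1 2 d isT d_gt1.
  by rewrite [X in (_ <= X.-1 %/ _)%N]p2 addn1 /= mulKn.
have m_lt_p : (m < p)%N by lia.
have f2 : Num.floor (1 / 2 * p.-1%:R : rat) = m%:Z.
  rewrite (_ : m = p.-1 %/ 2)%N; first exact: (@floor_divn p.-1 2).
  by rewrite [X in (X.-1 %/ _)%N]p2 addn1 /= mulKn.
rewrite (ev_padic_hypergeometric3 p_prime p_odd (sort_args d_gt1)
  (floor_divn _ d_gt0) f2 _ ud u2 ud' E1 E2 E3) ?n_le_m //.
rewrite (ev_hypergeometric_trunc p_prime E2 E1 E3).
have A1d : A1%:R * d%:R = 1 :> R by have := ev_ratr_mul pd dE; rewrite E1.
have A13 : A3%:R = 1 - A1%:R :> R.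
  have u1 : (denq 1)%:~R \is a @GRing.unit (padic_int p) by exact: unitr1.
  by rewrite -E3 -E1 (ratrB_unit u1 ud) rmorphB -(rmorph1 ev); congr (ev _ - _); exact: ratr_nat 1.
have A22 : A2%:R * 2%:R = 1 :> R by have := ev_ratr_mul p_2 twoE; rewrite E2.
(* The two cases are p = 1 and p = -1 modulo d. *)
have e_mul : (d * n + 1 = p)%N \/ (d * n.+1 = p.+1)%N.
  have cdp : coprime d p by rewrite coprime_sym prime_coprime.
  have := divn_eq p d; have := divn_eq p.-1 d; have := ltn_pmod p.-1 d_gt0.
  have p1S : p.-1.+1 = p by lia.
  have := divnS p.-1 d_gt0; rewrite p1S.
  case: (totient_le2_coprime d_gt1 d_totient cdp) => rE; rewrite rE.
    have -> : (d %| p)%N = false by rewrite /dvdn rE.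
    rewrite add0n => -> _ _ pE; left; rewrite [RHS]pE mulnC; lia.
  have -> : (d %| p)%N = false by apply/negbTE; rewrite /dvdn rE; lia.
  by rewrite add0n => -> _ _ pE; right; rewrite [in RHS]pE mulnS mulnC; lia.
have nd_mod A N (z : R) : A%:R = N.+1%:R + e * z -> A = N.+1 %[mod p].
  exact: Zp_pow2_mod.
have eB : A2%:R + m%:R = e * A2%:R :> R.
  have -> : e = m%:R * 2%:R + 1 :> R by rewrite -natrM natr1; congr (_ *+ _); rewrite -addn1 mulnC.
  by rewrite mulrDl mul1r -mulrA [2%:R * _]mulrC A22 mulr1 addrC.
have mB : A2 = m.+1 %[mod p].
  apply: (nd_mod _ _ (- A2%:R)).
  rewrite mulrN -eB -nat1r [A2%:R + _]addrC opprD addrA addrK.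
  have A22' : A2%:R + A2%:R = 1 :> R by move: A22; rewrite [_ * 2%:R]mulr_natr mulr2n.
  by apply/eqP; rewrite eq_sym subr_eq A22'.
have npm : (n < p)%N by clear -n_le_m m_lt_p; lia.
have eC C : C%:R + n%:R = e * A1%:R -> C = (p.-1 - n).+1 %[mod p].
  move=> CE; apply: (nd_mod _ _ (A1%:R - 1)).
  have -> : (p.-1 - n).+1 = (p - n)%N.
    by clear -npm; move: n npm => k npm; lia.
  rewrite natrB; last exact: ltnW.
  by rewrite mulrBr mulr1 -CE addrC subrKA addrK.
have dvdE X Y j : X = Y %[mod p] -> (p %| X + j)%N = (p %| Y + j)%N.
  by move=> eXY; rewrite /dvdn -modnDml eXY modnDml.
(* If p = dn + 1, then A1 is -n and A3 is n + 1 modulo p, so A3 plays the role of A and A1 that of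
   C. *)
case: e_mul => [ep|ep].
  have nA1 : A1%:R + n%:R = e * A1%:R :> R.
    have -> : e = n%:R * d%:R + 1 :> R.
      by rewrite -natrM natr1; congr (_ *+ _); rewrite -addn1 mulnC ep.
    by rewrite mulrDl mul1r -mulrA [d%:R * _]mulrC A1d mulr1 addrC.
  have mA3 : A3 = n.+1 %[mod p].
    apply: (nd_mod _ _ (- A1%:R)).
    by rewrite mulrN -nA1 -nat1r [A1%:R + _]addrC opprD addrA addrK.
  rewrite sum_lhs_termE // => [|j /andP[nj jm]]; last first.
    rewrite (dvdE _ _ _ (eC _ nA1)); apply/negP => /dvdnP[[|[|q]]];
    clear -nj jm p2 npm; nia.
  have := sum_lhs_term p_prime p_odd ee unitR annR n_le_m mA3 mB (eC _ nA1) eB nA1.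
  rewrite (eq_bigr (lhs_term p n A1 A2 A3 (A1%:R : R))) => [->|j _].
    by apply: eq_bigr => j _; rewrite -mulrA mulrC.
  have QC k : Q A1 k * Q A2 k * Q A3 k = Q A3 k * Q A2 k * Q A1 k.
    by rewrite mulrC mulrA [RHS]mulrAC.
  by rewrite /lhs_term !QC.
(* If p = d(n+1) - 1, then A1 is n + 1 and A3 is -n modulo p, and the roles are in the given
   order. *)
have nA1 : n.+1%:R - A1%:R = e * A1%:R :> R.
  have -> : e = n.+1%:R * d%:R - 1 :> R.
    by rewrite -natrM mulnC ep -natr1 addrK.
  by rewrite mulrBl mul1r -mulrA [d%:R * _]mulrC A1d mulr1.
have mA1 : A1 = n.+1 %[mod p].
  by apply: (nd_mod _ _ (- A1%:R)); rewrite mulrN -nA1 opprB addrC subrK.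
have nA3 : A3%:R + n%:R = e * A1%:R :> R.
  by rewrite A13 -nA1 -nat1r addrAC.
rewrite sum_lhs_termE // => [|j /andP[nj jm]]; last first.
  rewrite (dvdE _ _ _ mA1) gtnNdvd //; clear -nj jm p2; lia.
rewrite (sum_lhs_term p_prime p_odd ee unitR annR n_le_m mA1 mB (eC _ nA3) eB nA3).
by apply: eq_bigr => j _; congr (_ * _); exact: mulrC.
Qed.

End Supercongruence.

Theorem theorem4p4 (p d : nat) (p_prime : prime p) (d_bounds : (1 < d < p)%N)
    (d_totient : (totient d <= 2)%N) :
  padic_cong 2
    (padic_hypergeometric p [:: 1 / 2; 1 / d%:R; 1 - 1 / d%:R])
    (hypergeometric_trunc
       [:: ratr (1 / 2); ratr (1 / d%:R); ratr (1 - 1 / d%:R)] [:: 1; 1] 1 p.-1).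
Proof.
have /andP[d_gt1 d_ltp] := d_bounds.
have p_odd : odd p.
  by apply: contraTT d_ltp => /(prime_oddPn p_prime)->; rewrite -leqNgt.
exact/(padic_congP p_prime)/padic_hypergeometric_cong2.
Qed.
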